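(* Let $(\mathcal N,\mathcal O,\mathfrak l)$ be a plabic network representing a point $[A]\in\mathcal S^{\mathrm{TNN}}_{\mathcal M}\subset Gr^{\mathrm{TNN}}(k,n)$, with orientation $\mathcal O$ associated to the base $I=\{1\le i_1<i_2<\dots<i_k\le n\}$ in the matroid $\mathcal M$ and with gauge ray direction $\mathfrak l$. Assign vectors $B_j$ to the boundary sinks $b_j$, $j\in\bar I=[n]\setminus I$. Then the edge vector $$E_e=\sum_{j\in\bar I}\Big(\sum_{\mathcal P:\,e\to b_j}(-1)^{\mathrm{wind}(\mathcal P)+\mathrm{int}(\mathcal P)}w(\mathcal P)\Big)B_j$$ at any edge $e$ is a rational expression in the weights of the network with subtraction-free denominator: $$E_e=\sum_{j\in\bar I}\left[\frac{\displaystyle\sum_{F\in\mathcal F_{e,b_j}(\mathcal G)}(-1)^{\mathrm{wind}(F)+\mathrm{int}(F)}\,w(F)}{\displaystyle\sum_{C\in\mathcal C(\mathcal G)}w(C)}\right]B_j .$$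
   Context: $Gr^{\mathrm{TNN}}(k,n)=GL_k^+\backslash Mat^{\mathrm{TNN}}_{k,n}$, where $Mat^{\mathrm{TNN}}_{k,n}$ is the set of real $k\times n$ matrices of rank $k$ with non-negative maximal minors $\Delta_J$. For a matroid $\mathcal M$ (collection of $k$-subsets of $[n]$), $\mathcal S^{\mathrm{TNN}}_{\mathcal M}=\{[A]:\Delta_J(A)>0\text{ if }J\in\mathcal M,\ \Delta_J(A)=0\text{ if }J\notin\mathcal M\}$. Fix positive integers $k<n$. A plabic graph $\mathcal G$ of type $(k,n)$ is a finite directed graph drawn planarly in a disk, with no component isolated from the boundary, such that: it has $n$ boundary vertices $b_1,\dots,b_n$ labelled clockwise, all on a common straight interval of the boundary of the disk, each of degree 1 (a boundary source if its edge is outgoing, a boundary sink if incoming; exactly $k$ are sources); all other (internal) vertices are strictly inside the disk and are bivalent or trivalent; each internal vertex either has exactly one incoming edge (white) or exactly one outgoing edge (black), bivalent vertices being assigned either colour. Edges are straight segments, regarded as vectors directed by the orientation $\mathcal O$. $I$ indexes the boundary sources. A plabic network $\mathcal N$ is a plabic graph with a positive weight $w_e$ on each edge. $\mathcal N$ represents $[A]$ if $[A]$ is the class of the matrix with identity submatrix in the columns $I$ and entries $A^r_j=(-1)^{\sigma(i_r,j)}\sum_{P:b_{i_r}\to b_j}(-1)^{\mathrm{wind}_{top}(P)}w(P)$ for $j\in\bar I$, where $\sigma(i_r,j)$ is the number of elements of $I$ strictly between $i_r$ and $j$, the sum is over directed walks from $b_{i_r}$ to $b_j$, and $\mathrm{wind}_{top}$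 is the topological winding index ($(-1)^{\mathrm{wind}_{top}(P)}=(-1)^{\text{number of loops removed in the loop erasure of }P}$). A gauge ray direction $\mathfrak l$ is an oriented direction such that the ray in direction $\mathfrak l$ from any boundary vertex points inside the disk, no internal edge is parallel to $\mathfrak l$, and the rays starting at boundary vertices contain no internal vertices. $\mathfrak l_i$ is the ray starting at $b_i$. For plane vectors $s(u,v)=+1,0,-1$ if $(u,v)$ is positively (counterclockwise) oriented, parallel, negatively oriented. For consecutive edges, $\mathrm{wind}(e,f)=\pm1$ if $s(e,f)=s(e,\mathfrak l)=s(\mathfrak l,f)=\pm1$, and $0$ otherwise. $\mathrm{int}(e)$ is the number of intersections of $e$ with the rays $\mathfrak l_{i_r}$, $r\in[k]$ (the common starting point of $\mathfrak l_{i_r}$ and the edge at $b_{i_r}$ is not counted). For a directed path $\mathcal P=(e_1,\dots,e_m)$ (edges may repeat): $w(\mathcal P)=\prod w_{e_l}$ with multiplicity, $\mathrm{wind}(\mathcal P)=\sum_{l=1}^{m-1}\mathrm{wind}(e_l,e_{l+1})$, $\mathrm{int}(\mathcal P)=\sum_{l=1}^m\mathrm{int}(e_l)$. $\mathcal P:e\to b_j$ means a directed path with first edge $e$ ending at $b_j$; the (possibly infinite) sum over such paths is a formal power series in the weights, convergent for sufficiently small weights, and an empty sum is $0$. Edge loop-erased walk: a directed path starting with $e$ and ending at $b_j$ with all edges distinct. An edge flow at $e$ is a collection $F$ of distinct edges such that: $e\in F$; at every internal vertex other than the starting vertex $V$ of $e$ the number of edges of $F$ arriving equals the number leaving; at $V$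 the number arriving equals the number leaving minus 1; $F$ contains no edges at boundary sources except possibly $e$. $\mathcal F_{e,b_j}(\mathcal G)$ is the set of edge flows at $e$ containing the edge at the sink $b_j$; each such $F$ is the union of an edge loop-erased walk $P_{e,b_j}$ from $e$ to $b_j$ and a (possibly trivial) conservative flow having no common edges with it. $w(F)$ is the product of the weights of the edges in $F$, $\mathrm{wind}(F)=\mathrm{wind}(P_{e,b_j})$, $\mathrm{int}(F)=\mathrm{int}(P_{e,b_j})$. A conservative flow is a collection $C$ of distinct edges, none incident to the boundary, such that at each internal vertex the numbers of edges of $C$ arriving and leaving coincide; $\mathcal C(\mathcal G)$ is the set of conservative flows, including the empty one with weight 1, and $w(C)$ is the product of the weights of its edges. *)

(* Defs.v *)
From mathcomp Require Import all_boot all_order all_algebra.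
From mathcomp Require Import mpoly.
From mathcomp Require Import boolp classical_sets reals topology normedtype sequences.

Set Implicit Arguments.
Unset Strict Implicit.
Unset Printing Implicit Defensive.

Import Order.TTheory GRing.Theory Num.Theory.
Import numFieldNormedType.Exports.

Local Open Scope ring_scope.

Section Plane.
Variable R : realType.
Implicit Types (u v x y : R * R).

Definition cross u v : R := u.1 * v.2 - u.2 * v.1.

(* s(u,v): +1 counterclockwise, 0 parallel, -1 clockwise *)
Definition orient u v : int := sgz (cross u v).

(* Winding of the turn from direction u to direction v, with respect to l. *)
Definition turn_wind (l u v : R * R) : int :=
  if (orient u v == orient u l) && (orient u l == orient l v)
  then orient u v else 0.

Definition on_segment x y : set (R * R) :=
  [set z | exists t : R, 0 <= t <= 1 /\ z = x + t *: (y - x)]%classic.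

Definition unit_disk : set (R * R) :=
  [set z | z.1 ^+ 2 + z.2 ^+ 2 <= 1]%classic.
Definition unit_open_disk : set (R * R) :=
  [set z | z.1 ^+ 2 + z.2 ^+ 2 < 1]%classic.
Definition unit_circle : set (R * R) :=
  [set z | z.1 ^+ 2 + z.2 ^+ 2 = 1]%classic.

(* A closed topological disk in the plane, as the image of the closed unit
   disk under a homeomorphism.  (A round disk has no straight interval in its
   boundary; no convexity or regularity is assumed.) *)
Record disk := Disk {
  dmap : R * R -> R * R;
  dinv : R * R -> R * R;
  dmap_continuous : {within unit_disk, continuous dmap}%classic;
  dinv_continuous : {within (dmap @` unit_disk), continuous dinv}%classic;
  dmapK : forall z, unit_disk z -> dinv (dmap z) = z
}.

Definition disk_set (D : disk) : set (R * R) := (dmap D @` unit_disk)%classic.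
Definition disk_inside (D : disk) : set (R * R) :=
  (dmap D @` unit_open_disk)%classic.
Definition disk_boundary (D : disk) : set (R * R) :=
  (dmap D @` unit_circle)%classic.

Definition points_inside (D : disk) (x v : R * R) : Prop :=
  exists2 eps : R, 0 < eps &
    forall t : R, 0 < t < eps -> disk_inside D (x + t *: v).

(* The segment from p to q is part of the boundary, and the clockwise
   orientation of the boundary goes from p to q: the inside of the disk lies to
   the right of q - p. *)
Definition straight_boundary_interval (D : disk) (p q : R * R) : Prop :=
  [/\ p <> q,
      forall z, on_segment p q z -> disk_boundary D z &
      forall t : R, 0 < t < 1 ->
        points_inside D (p + t *: (q - p)) ((q - p).2, - (q - p).1)].

End Plane.

(* A directed graph drawn with straight edges, with n marked boundary vertices
   b_i = inl i; internal vertices are inr v. *)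
Record drawing (R : realType) (n : nat) := Drawing {
  nv : nat;
  ne : nat;
  tail : 'I_ne -> 'I_n + 'I_nv;
  head : 'I_ne -> 'I_n + 'I_nv;
  white : pred 'I_nv;
  pos : 'I_n + 'I_nv -> R * R;
  in_disk : disk R
}.

Section Graph.
Variables (R : realType) (n : nat) (G : drawing R n).

Local Notation vertex := ('I_n + 'I_(nv G))%type.
Local Notation edge := 'I_(ne G).

Definition in_edges (v : vertex) : {set edge} := [set f | head f == v]%SET.
Definition out_edges (v : vertex) : {set edge} := [set f | tail f == v]%SET.
Definition indeg (v : vertex) : nat := #|in_edges v|.
Definition outdeg (v : vertex) : nat := #|out_edges v|.

Definition incident (v : vertex) (f : edge) : bool :=
  (tail f == v) || (head f == v).

Definition adjacent (u v : vertex) : bool :=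
  [exists f : edge, (u != v) && incident u f && incident v f].

Definition is_boundary (v : vertex) : bool := if v is inl _ then true else false.
Definition internal_edge (f : edge) : bool :=
  ~~ is_boundary (tail f) && ~~ is_boundary (head f).

Definition on_edge (f : edge) : set (R * R) :=
  on_segment (pos (tail f)) (pos (head f)).
Definition edge_dir (f : edge) : R * R := pos (head f) - pos (tail f).

Definition sources : {set 'I_n} := [set b : 'I_n | outdeg (inl b) == 1%N]%SET.

Record plabic (k : nat) : Prop := Plabic {
  boundary_deg1 : forall b : 'I_n, (indeg (inl b) + outdeg (inl b) = 1)%N;
  card_sources : #|sources| = k;
  internal_deg23 : forall v : 'I_(nv G),
    (indeg (inr v) + outdeg (inr v) = 2)%N \/
    (indeg (inr v) + outdeg (inr v) = 3)%N;
  white_indeg1 : forall v : 'I_(nv G), white v -> indeg (inr v) = 1%N;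
  black_outdeg1 : forall v : 'I_(nv G), ~~ white v -> outdeg (inr v) = 1%N;
  not_isolated : forall v : 'I_(nv G),
    exists b : 'I_n, connect adjacent (inr v) (inl b);
  edge_nondegenerate : forall f : edge, tail f != head f;
  pos_inj : injective (@pos R n G);
  edges_in_disk : forall f z, on_edge f z -> disk_set (in_disk G) z;
  internal_inside : forall v : 'I_(nv G), disk_inside (in_disk G) (pos (inr v));
  planar : forall (f g : edge) z, f != g -> on_edge f z -> on_edge g z ->
    exists v, [/\ z = pos v, incident v f & incident v g];
  (* b_1, ..., b_n occur in this order, clockwise, on a straight interval *)
  boundary_on_interval : exists p q (t : 'I_n -> R),
    [/\ straight_boundary_interval (in_disk G) p q,
        forall b, 0 <= t b <= 1 /\ pos (inl b : vertex) = p + t b *: (q - p) &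
        forall b c : 'I_n, (b < c)%N -> t b < t c]
}.

Definition on_ray (l : R * R) (b : 'I_n) : set (R * R) :=
  [set z | exists2 t : R, 0 <= t & z = pos (inl b : vertex) + t *: l]%classic.

Definition gauge_direction (l : R * R) : Prop :=
  [/\ l != 0,
      forall b : 'I_n, points_inside (in_disk G) (pos (inl b : vertex)) l,
      forall f : edge, internal_edge f -> cross (edge_dir f) l != 0 &
      forall (b : 'I_n) (v : 'I_(nv G)), ~ on_ray l b (pos (inr v))].

Definition follows (f g : edge) : bool := head f == tail g.

Definition path_to (e : edge) (j : 'I_n) (P : seq edge) : bool :=
  if P is f :: s then [&& f == e, path follows f s & head (last f s) == inl j]
  else false.

Definition walk_from_to (b j : 'I_n) (P : seq edge) : bool :=
  if P is f :: s
  then [&& tail f == inl b, path follows f s & head (last f s) == inl j]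
  else false.

Section Gauge.
Variable l : R * R.

Definition path_wind (P : seq edge) : int :=
  \sum_(fg <- zip P (behead P)) turn_wind l (edge_dir fg.1) (edge_dir fg.2).

(* A ray and an edge not parallel to it have at most one common point, so that
   the intersections are counted by the source from which the ray starts; the
   starting point itself is excluded. *)
Definition edge_int (f : edge) : nat :=
  #|[set b in sources |
      `[< exists z, [/\ on_edge f z, on_ray l b z & z <> pos (inl b : vertex)] >]]%SET|.

Definition path_int (P : seq edge) : nat := (\sum_(f <- P) edge_int f)%N.

(* (-1)^(wind P + int P), in any ring *)
Definition path_sign (S : nzRingType) (P : seq edge) : S :=
  (-1) ^+ absz (path_wind P + (path_int P)%:Z).

End Gauge.

Definition conservative (C : {set edge}) : bool :=
  [forall f in C, internal_edge f] &&
  [forall v : 'I_(nv G),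
     #|C :&: in_edges (inr v)| == #|C :&: out_edges (inr v)|].

Definition edge_flow (e : edge) (F : {set edge}) : bool :=
  [&& e \in F,
      [forall v : 'I_(nv G), (inr v != tail e) ==>
         (#|F :&: in_edges (inr v)| == #|F :&: out_edges (inr v)|)],
      #|F :&: in_edges (tail e)|.+1 == #|F :&: out_edges (tail e)| &
      [forall f in F, is_boundary (tail f) ==> (f == e)]].

(* F_{e, b_j} *)
Definition edge_flow_to (e : edge) (j : 'I_n) (F : {set edge}) : bool :=
  edge_flow e F && [exists f in F, head f == inl j].

(* The edge loop-erased walk P_{e, b_j} contained in an edge flow F. *)
Definition flow_walk (e : edge) (j : 'I_n) (F : {set edge}) : seq edge :=
  xget [::] [set P | [/\ path_to e j P, uniq P, {subset P <= F} &
                         conservative (F :\: [set f in P]%SET)]]%classic.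

(* The denominator and the numerators, with the edge variables specialised to
   the elements x f of a commutative ring: either the weights or the
   indeterminates. *)
Definition conservative_gf (S : comNzRingType) (x : edge -> S) : S :=
  \sum_(C : {set edge} | conservative C) \prod_(f in C) x f.

Definition edge_flow_gf (l : R * R) (S : comNzRingType) (x : edge -> S)
    (e : edge) (j : 'I_n) : S :=
  \sum_(F : {set edge} | edge_flow_to e j F)
    path_sign l S (flow_walk e j F) * \prod_(f in F) x f.

Definition path_weight (w : edge -> R) (P : seq edge) : R := \prod_(f <- P) w f.

End Graph.

(* Formal power series in m indeterminates, given by their coefficients. *)
Section FormalSeries.
Variables (R : realType) (m : nat).

Definition fps := 'X_{1..m} -> R.

Definition fps_mul (q : {mpoly R[m]}) (S : fps) : fps := fun mu =>
  \sum_(a : 'X_{1..m < (mdeg mu).+1} | (bmnm a <= mu)%MM)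
     q@_(bmnm a) * S (mu - bmnm a)%MM.

(* Value at w of a series which is the expansion of a rational function p / q
   regular at w: the reading of a formal series of weights at weights for which
   it need not converge. *)
Definition fps_value (S : fps) (w : 'I_m -> R) : R :=
  xget 0 [set v | exists p q : {mpoly R[m]},
    [/\ forall mu, fps_mul q S mu = p@_mu, q.@[w] != 0 &
        v = p.@[w] / q.@[w]]]%classic.

(* sum over the edge sequences P satisfying D of sg P * (monomial of P) *)
Definition path_series (D : pred (seq 'I_m)) (sg : seq 'I_m -> R) : fps :=
  fun mu =>
  \sum_(P : (mdeg mu).-tuple 'I_m |
          D P && ([multinom count_mem f P | f < m] == mu)) sg P.

End FormalSeries.

Section Grassmannian.
Variables (R : realType) (k n : nat).

(* The columns of a k-subset J of [n] are listed by the increasing map f with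
   image J. *)
Definition increasing (f : 'I_k -> 'I_n) : Prop :=
  forall r s : 'I_k, (r < s)%N -> (f r < f s)%N.

Definition maxminor (f : 'I_k -> 'I_n) (A : 'M[R]_(k, n)) : R :=
  \det (colsub f A).

Definition mat_tnn (A : 'M[R]_(k, n)) : Prop :=
  \rank A = k /\ forall f, increasing f -> 0 <= maxminor f A.

Definition matroid (M : {set {set 'I_n}}) : Prop :=
  [/\ M != finset.set0,
      forall J, J \in M -> #|J| = k &
      forall J K x, J \in M -> K \in M -> x \in J :\: K ->
        exists2 y, y \in K :\: J & y |: (J :\ x) \in M].

(* [A] belongs to the cell S_M^TNN *)
Definition in_tnn_cell (M : {set {set 'I_n}}) (A : 'M[R]_(k, n)) : Prop :=
  mat_tnn A /\ forall f, increasing f ->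
    (f @: [set: 'I_k]%SET \in M -> 0 < maxminor f A) /\
    (f @: [set: 'I_k]%SET \notin M -> maxminor f A = 0).

(* [A] = [B] in GL_k^+ \ Mat_{k,n} *)
Definition same_class (A B : 'M[R]_(k, n)) : Prop :=
  exists2 g : 'M[R]_k, 0 < \det g & A = g *m B.

End Grassmannian.

(* Number of loops removed in the chronological loop erasure of a walk given by
   its vertices; acc is the part of the loop-erased walk built so far, most
   recent vertex first. *)
Fixpoint loops_erased_aux (T : eqType) (acc s : seq T) : nat :=
  if s is v :: s' then
    if v \in acc then (loops_erased_aux (drop (index v acc) acc) s').+1
    else loops_erased_aux (v :: acc) s'
  else 0%N.

Section Network.
Variables (R : realType) (k n : nat) (G : drawing R n).
Local Notation edge := 'I_(ne G).

Definition loops_erased (P : seq edge) : nat :=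
  if P is f :: _ then loops_erased_aux [:: tail f] [seq head g | g <- P] else 0%N.

Definition sources_between (b j : 'I_n) : nat :=
  #|[set c in sources G | (minn b j < c < maxn b j)%N]%SET|.

Definition boundary_measurement (w : edge -> R) (b j : 'I_n) : R :=
  fps_value (path_series (walk_from_to b j) (fun P => (-1) ^+ loops_erased P)) w.

(* i lists the base I in increasing order *)
Definition network_matrix (w : edge -> R) (i : 'I_k -> 'I_n) : 'M[R]_(k, n) :=
  \matrix_(r < k, j < n)
    if j \in sources G then (i r == j)%:R
    else (-1) ^+ sources_between (i r) j * boundary_measurement w (i r) j.

Definition represents (w : edge -> R) (i : 'I_k -> 'I_n) (A : 'M[R]_(k, n)) :=
  same_class A (network_matrix w i).

(* sum over P : e -> b_j of (-1)^(wind P + int P) w(P) *)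
Definition edge_series (l : R * R) (e : edge) (j : 'I_n) : fps R (ne G) :=
  path_series (path_to e j) (path_sign l R).

Definition edge_vector (l : R * R) (w : edge -> R) (V : lmodType R)
    (B : 'I_n -> V) (e : edge) : V :=
  \sum_(j | j \notin sources G) fps_value (edge_series l e j) w *: B j.

(* The same sum in R, its terms grouped by the length of the path. *)
Definition edge_term (l : R * R) (w : edge -> R) (e : edge) (j : 'I_n) :
    nat -> R := fun m =>
  \sum_(P : m.-tuple edge | path_to e j P) path_sign l R P * path_weight w P.

Definition edge_abs_term (w : edge -> R) (e : edge) (j : 'I_n) : nat -> R :=
  fun m => \sum_(P : m.-tuple edge | path_to e j P) `|path_weight w P|.

Definition edge_indeterminate (f : edge) : {mpoly R[ne G]} := 'X_f.

End Network.

(* Main.v *)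
(* Both the winding and the intersection numbers are additive over the steps of a
   walk, so the signed sum over the walks from e to b_j is an entry of (1 - T)^-1,
   up to the last step, for a signed transfer matrix T indexed by the edges; by
   Cramer's rule it is a cofactor of 1 - T divided by det (1 - T).  Expanding both
   over permutations of the edges, the permutations with a nonzero term are exactly
   the conservative flows, respectively the edge flows from e to b_j (closed up by
   sending the edge at b_j back to e), because at most one edge of a flow arrives at
   a vertex.  All terms of det (1 - T) are positive because every simple directed
   cycle has sign -1: the gauge direction is swept an odd number of times (Hopf's
   Umlaufsatz mod 2), and each gauge ray starts at a boundary point of the disk,
   from which it crosses a closed curve in the disk an even number of times, since
   the disk minus a boundary point is contractible.  The series identities follow
   from (1 - T) (1 + T + ... + T^(N-1)) = 1 - T^N, either by comparing coefficients
   of low degree or by letting N tend to infinity. *)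
Require Import Defs.
From mathcomp Require Import all_boot all_order all_algebra all_fingroup.
From mathcomp Require Import mpoly.
From mathcomp Require Import boolp classical_sets reals topology normedtype sequences.
From mathcomp Require Import ring lra zify.
Import Order.TTheory GRing.Theory Num.Theory.
Import numFieldNormedType.Exports.
Local Open Scope ring_scope.

Set Implicit Arguments.
Unset Strict Implicit.
Unset Printing Implicit Defensive.

(** * Winding numbers mod 2 in the plane *)

(** Only parities of windings and of intersections matter, so one Boolean, [sweeps], measures both:
    between two consecutive edge directions it is the winding of the turn mod 2, and between the end
    points of an edge as seen from a source it tells whether the edge meets the gauge ray. It is a
    cocycle on triangles that miss the origin, so homotopy invariance becomes a sum over a finite
    triangulation, without angles, liftings or the Jordan curve theorem. Chords and contracted
    points, unlike internal edges, may be parallel to [l]; this is why the line of [l] has to be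
    distributed between the two half-planes. The disk is known only up to homeomorphism, so its
    contraction is carried over from the round disk and made discrete by compactness. The algebra is
    done with the adjugate over an arbitrary commutative ring, so that a single identity serves the
    indeterminates and the real weights. *)

Section HalfPlane.
Variables (R : realType) (l : R * R).
Hypothesis l_neq0 : l != 0.
Implicit Types a b d p : R * R.

Definition dot a b : R := a.1 * b.1 + a.2 * b.2.

(* The half-plane to the right of [l], its boundary line being split by an
   infinitesimal rotation: [l] counts as right and [- l] as left. *)
Definition right_half a : bool :=
  (0 < cross a l) || ((cross a l == 0) && (0 < dot a l)).

(* Whether the segment from [a] to [b] crosses the ray spanned by [l]. *)
Definition sweeps a b : bool :=
  (right_half a != right_half b) &&
  (0 < if right_half a then cross a b else cross b a).

(** The closed triangle, possibly degenerate, misses the origin. Barycentric weights are left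
    unnormalised so that witnesses need no division. *)
Definition tri_avoids0 a b d : Prop := forall x y z : R,
  0 <= x -> 0 <= y -> 0 <= z -> 0 < x + y + z ->
  x * a.1 + y * b.1 + z * d.1 = 0 -> x * a.2 + y * b.2 + z * d.2 = 0 -> False.

Lemma tri_avoids0_rot {a b d} : tri_avoids0 a b d -> tri_avoids0 b d a.
Proof.
move=> h x y z x0 y0 z0 s0 e1 e2.
by apply: (h z x y) => //; [move: s0 | move: e1 | move: e2]; lra.
Qed.

Lemma tri_avoids0_swap {a b d} : tri_avoids0 a b d -> tri_avoids0 b a d.
Proof.
move=> h x y z x0 y0 z0 s0 e1 e2.
by apply: (h y x z) => //; [move: s0 | move: e1 | move: e2]; lra.
Qed.

Lemma sweepsC a b : sweeps a b = sweeps b a.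
Proof. by rewrite /sweeps; do 2 case: right_half. Qed.

Lemma sweeps_same a b : right_half a = right_half b -> sweeps a b = false.
Proof. by rewrite /sweeps => ->; rewrite eqxx. Qed.

Lemma cross_dot_eq0 a : cross a l = 0 -> dot a l = 0 -> a.1 = 0 /\ a.2 = 0.
Proof.
move: l_neq0; case: l => l1 l2; case: a => a1 a2; rewrite /cross /dot /=.
rewrite -[0]/(0 : R, 0 : R) xpair_eqE negb_and => hl c0 d0.
have sq : 0 < l1 ^+ 2 + l2 ^+ 2.
  case/orP: hl => hl.
    by apply: ltr_wpDr; [exact: sqr_ge0 | rewrite lt0r sqrf_eq0 hl sqr_ge0].
  by apply: ltr_wpDl; [exact: sqr_ge0 | rewrite lt0r sqrf_eq0 hl sqr_ge0].
have e1 : a1 * (l1 ^+ 2 + l2 ^+ 2) = 0.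
  have -> : a1 * (l1 ^+ 2 + l2 ^+ 2) = l2 * (a1 * l2 - a2 * l1) + l1 * (a1 * l1 + a2 * l2) by ring.
  by rewrite c0 d0; ring.
have e2 : a2 * (l1 ^+ 2 + l2 ^+ 2) = 0.
  have -> : a2 * (l1 ^+ 2 + l2 ^+ 2) = - l1 * (a1 * l2 - a2 * l1) + l2 * (a1 * l1 + a2 * l2) by ring.
  by rewrite c0 d0; ring.
by split; apply/eqP; [move/eqP: e1 | move/eqP: e2]; rewrite mulf_eq0 (gt_eqF sq) orbF.
Qed.

Lemma right_half_ge0 {a} : right_half a -> 0 <= cross a l.
Proof. by case/orP => [/ltW//|/andP[/eqP-> _]]. Qed.

Lemma left_half_le0 {a} : right_half a = false -> cross a l <= 0.
Proof. by move/norP => [+ _]; rewrite -leNgt. Qed.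

Lemma right_half_opp a : a != 0 -> right_half (- a) = ~~ right_half a.
Proof.
move=> a0; rewrite /right_half.
have -> : cross (- a) l = - cross a l by rewrite /cross /=; ring.
have -> : dot (- a) l = - dot a l by rewrite /dot /=; ring.
rewrite !oppr_gt0 oppr_eq0.
case: ltgtP => //= c0; case: ltgtP => //= d0.
have [e1 e2] := cross_dot_eq0 c0 d0.
by move: a0; rewrite -[_ == _]/((a.1 == 0) && (a.2 == 0)) e1 e2 eqxx.
Qed.

(** If the segment from [a] to [d] passes over [l] while the one from [b] to [d] does not, the
    latter passes over [- l] or through the origin, and the triangle contains the origin. *)
Lemma sweeps_tri_half a b d : tri_avoids0 a b d ->
  right_half a -> right_half b -> right_half d = false ->
  0 < cross a d -> 0 < cross b d.
Proof.
move=> av /right_half_ge0 ha /right_half_ge0 hb hd cad.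
have {}hd : cross d l < 0.
  rewrite lt_neqAle left_half_le0 // andbT; apply/eqP => d0.
  have dd : dot d l <= 0 by move: hd; rewrite /right_half d0 ltxx eqxx /= leNgt => ->.
  have [] : (cross a d * dot l l = dot d l * cross a l - cross d l * dot a l) by rewrite /cross /dot; ring.
  rewrite d0 mul0r subr0 => e.
  have : 0 < cross a d * dot l l.
    rewrite mulr_gt0 // /dot lt0r addr_ge0 -?expr2 ?sqr_ge0 // andbT.
    rewrite paddr_eq0 ?sqr_ge0 // !sqrf_eq0; move: l_neq0.
    by case: l => l1 l2; rewrite -[0]/(0 : R, 0 : R) xpair_eqE.
  by rewrite e ltNge mulr_le0_ge0.
rewrite ltNge; apply/negP => cbd.
have id1 : cross b d * cross a l + cross d a * cross b l + cross a b * cross d l = 0.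
  by rewrite /cross; ring.
have cda : cross d a = - cross a d by rewrite /cross; ring.
have cab : cross a b <= 0.
  rewrite leNgt; apply/negP => cab.
  have : 0 < - (cross a b * cross d l) by rewrite -mulrN mulr_gt0 // oppr_gt0.
  have : cross b d * cross a l <= 0 by rewrite mulr_le0_ge0.
  have : 0 <= cross a d * cross b l by rewrite mulr_ge0 // ltW.
  by move: id1; rewrite cda; lra.
(* Up to a common sign these are the coefficients of the identity [cross b d * a + cross d a * b +
   cross a b * d = 0]; all are now nonnegative and the middle one is positive. *)
apply: (av (- cross b d) (cross a d) (- cross a b)).
- by rewrite oppr_ge0.
- exact: ltW.
- by rewrite oppr_ge0.
- by lra.
- by rewrite /cross; ring.
- by rewrite /cross; ring.
Qed.

Lemma cross_opp2 a b : cross (- a) (- b) = cross a b.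
Proof. by rewrite /cross /=; ring. Qed.

Lemma tri_avoids0_neq0 a b d : tri_avoids0 a b d -> [/\ a != 0, b != 0 & d != 0].
Proof.
move=> av; have ge0 := (lexx (0 : R)); have ge1 := (@ler01 R).
have g1 : 0 < 1 + 0 + 0 :> R by rewrite !addr0.
split; apply/eqP => e.
- by apply: (av 1 0 0) => //; rewrite e /=; ring.
- by apply: (av 0 1 0); rewrite ?e //=; try ring; rewrite add0r addr0 ltr01.
- by apply: (av 0 0 1); rewrite ?e //=; try ring; rewrite !add0r ltr01.
Qed.

Lemma tri_avoids0_opp a b d : tri_avoids0 a b d -> tri_avoids0 (- a) (- b) (- d).
Proof.
by move=> h x y z x0 y0 z0 s0 e1 e2; apply: (h x y z) => //;
  [move: e1 | move: e2] => /=; lra.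
Qed.

(** Parallel vectors on different sides point in opposite directions, or [b] vanishes; either way
    the segment between them contains the origin. *)
Lemma tri_cross_neq0 a b d : tri_avoids0 a b d ->
  right_half a -> right_half b = false -> cross a b != 0.
Proof.
move=> av ha hb; apply/eqP => c0.
have xa := right_half_ge0 ha; have xb := left_half_le0 hb.
have [s0|s0] := ltP 0 (cross a l - cross b l).
  have e : cross a b * l.1 = 0 /\ cross a b * l.2 = 0 by rewrite c0 !mul0r.
  apply: (av (- cross b l) (cross a l) 0) => //; rewrite ?oppr_ge0 //; first by lra.
    by rewrite -[RHS](proj1 e) /cross; ring.
  by rewrite -[RHS](proj2 e) /cross; ring.
have xa0 : cross a l = 0 by lra.
have xb0 : cross b l = 0 by lra.
move: ha hb; rewrite /right_half xa0 xb0 ltxx eqxx /= => da /negbT; rewrite -leNgt => db.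
have [] : (dot a l * b.1 - dot b l * a.1, dot a l * b.2 - dot b l * a.2).1 = 0 /\
          (dot a l * b.1 - dot b l * a.1, dot a l * b.2 - dot b l * a.2).2 = 0.
  apply: cross_dot_eq0; last by rewrite /dot /=; ring.
  rewrite [LHS](_ : _ = dot a l * cross b l - dot b l * cross a l).
    2: by rewrite /cross /=; ring.
  by rewrite xa0 xb0; ring.
move=> /= e1 e2; apply: (av (- dot b l) (dot a l) 0) => //; rewrite ?oppr_ge0 // ?(ltW da) //; first by lra.
  by rewrite -[RHS]e1; ring.
by rewrite -[RHS]e2; ring.
Qed.

Lemma sweeps_tri_eq a b d : tri_avoids0 a b d ->
  right_half a = right_half b -> sweeps a d = sweeps b d.
Proof.
move=> av; have [a0 b0 d0] := tri_avoids0_neq0 av.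
have cC (u v : R * R) : cross u v = - cross v u by rewrite /cross; ring.
rewrite /sweeps; case hd: (right_half d); case ha: (right_half a) => /esym hb;
  rewrite ?ha ?hb //=; last first.
  by apply/idP/idP; apply: sweeps_tri_half => //; exact: tri_avoids0_swap.
(* Negation exchanges the half-planes and preserves [cross], so it yields the statement for the ray
   of [- l]; since the cross products do not vanish, the statement for [l] is its complement. *)
have ov := tri_avoids0_opp av.
have nd : right_half (- d) = false by rewrite right_half_opp ?hd.
have na : right_half (- a) = true by rewrite right_half_opp ?ha.
have nb : right_half (- b) = true by rewrite right_half_opp ?hb.
have ab := sweeps_tri_half ov na nb nd.
have ba := sweeps_tri_half (tri_avoids0_swap ov) nb na nd.
have ca : cross d a != 0.
  by apply: (@tri_cross_neq0 _ _ b) => //; exact: tri_avoids0_rot (tri_avoids0_rot av).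
have cb : cross d b != 0.
  apply: (@tri_cross_neq0 _ _ a) => //.
  exact: tri_avoids0_swap (tri_avoids0_rot av).
move: ab ba; rewrite !cross_opp2 (cC a d) (cC b d) !oppr_gt0 => ab ba.
by case: ltgtP ca ab ba => // _ _; case: ltgtP cb => // _ _ H1 H2; exfalso;
  [have := H1 isT | have := H2 isT].
Qed.

(** Two of the three vertices lie in the same half-plane: the side joining them crosses nothing, and
    the other two sides agree by [sweeps_tri_eq]. *)
Lemma sweeps_tri a b d : tri_avoids0 a b d ->
  sweeps a b (+) sweeps b d = sweeps a d.
Proof.
move=> av.
have [ab|ab] := eqVneq (right_half a) (right_half b).
  by rewrite (sweeps_same ab) (sweeps_tri_eq av ab).
have [bd|bd] := eqVneq (right_half b) (right_half d).
  rewrite (sweeps_same bd) addbF !(sweepsC a).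
  exact: (sweeps_tri_eq (tri_avoids0_rot av)).
have ad : right_half a = right_half d.
  by move: ab bd; do 3 case: right_half.
rewrite (sweeps_same ad) (sweepsC b) (sweeps_tri_eq _ ad) ?addbb //.
exact: tri_avoids0_swap (tri_avoids0_rot (tri_avoids0_rot av)).
Qed.

(** A segment that changes half-plane and misses the origin crosses exactly one of the rays of [l]
    and [- l], and negation exchanges these rays. *)
Lemma sweeps_opp a b d : tri_avoids0 a b d ->
  right_half a = false -> right_half b -> sweeps a b (+) sweeps (- a) (- b).
Proof.
move=> av ha hb; have [a0 b0 _] := tri_avoids0_neq0 av.
have := tri_cross_neq0 (tri_avoids0_swap av) hb ha.
rewrite /sweeps !right_half_opp // ha hb /= !cross_opp2.
have -> : cross a b = - cross b a by rewrite /cross; ring.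
by rewrite oppr_gt0; case: ltgtP.
Qed.

(** With [right_halfD], this makes [right_half] the positive cone of a lexicographic order of the
    plane, whose minimum over a cycle is the extremal vertex for the Umlaufsatz. *)
Lemma right_half_lex a : right_half a \/ right_half (- a) \/ a = 0.
Proof.
have [->|/right_half_opp ->] := eqVneq a 0; first by right; right.
by case: right_half; [left | right; left].
Qed.

Lemma right_halfD a b : right_half a -> right_half b -> right_half (a + b).
Proof.
have eC : cross (a + b) l = cross a l + cross b l by rewrite /cross /=; ring.
have eD : dot (a + b) l = dot a l + dot b l by rewrite /dot /=; ring.
rewrite /right_half eC eD.
move=> /orP[xa|/andP[/eqP-> da]] /orP[xb|/andP[/eqP-> db]]; apply/orP.
- by left; rewrite addr_gt0.
- by left; rewrite addr0.
- by left; rewrite add0r.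
- by right; rewrite addr0 eqxx addr_gt0.
Qed.

Lemma right_half0 : right_half 0 = false.
Proof. by rewrite /right_half /cross /dot /= !mul0r subrr addr0 ltxx andbF. Qed.

(* Homotopy invariance of the winding number mod 2, in discrete form. *)
Lemma sweeps_strip (a b : nat -> R * R) (N : nat) :
  (forall j, (j < N)%N -> tri_avoids0 (a j) (a j.+1) (b j.+1)) ->
  (forall j, (j < N)%N -> tri_avoids0 (a j) (b j) (b j.+1)) ->
  \big[addb/false]_(j < N) sweeps (a j) (a j.+1) (+) sweeps (a N) (b N) =
  sweeps (a 0%N) (b 0%N) (+) \big[addb/false]_(j < N) sweeps (b j) (b j.+1).
Proof.
elim: N => [|N IH] ha hb; first by rewrite !big_ord0 addbF.
rewrite !big_ord_recr /= -addbA (sweeps_tri (ha N (ltnSn N))).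
rewrite -(sweeps_tri (hb N (ltnSn N))) addbA IH ?addbA // => j jN.
  by apply: ha; exact: ltnW.
by apply: hb; exact: ltnW.
Qed.

End HalfPlane.

(** * The Umlaufsatz mod 2 for simple closed polygons *)

Section Hopf.
Variables (R : realType) (l : R * R).
Hypothesis l_neq0 : l != 0.
Variables (n : nat) (v : nat -> R * R).
Local Notation m := (n.+3).
Hypotheses (vm : v m = v 0%N) (vm1 : v m.+1 = v 1%N).
Hypothesis v0_extremal : forall j, (0 < j < m)%N -> right_half l (v j - v 0%N).
Hypothesis edges_meet : forall (i j : nat) (s t : R), (i < j < m)%N ->
  0 <= s <= 1 -> 0 <= t <= 1 ->
  (1 - s) * (v i).1 + s * (v i.+1).1 = (1 - t) * (v j).1 + t * (v j.+1).1 ->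
  (1 - s) * (v i).2 + s * (v i.+1).2 = (1 - t) * (v j).2 + t * (v j.+1).2 ->
  [/\ j = i.+1, s = 1 & t = 0] \/ [/\ i = 0%N, j = m.-1, s = 0 & t = 1].

Let u i j := v j - v i.

(** The parameters are multiplied by the total weight [S] of a triangle, to match the unnormalised
    weights of [tri_avoids0]. *)
Let meet_scaled (i j : nat) (S s t : R) : (i < j < m)%N -> 0 < S ->
  0 <= s <= S -> 0 <= t <= S ->
  (S - s) * (v i).1 + s * (v i.+1).1 = (S - t) * (v j).1 + t * (v j.+1).1 ->
  (S - s) * (v i).2 + s * (v i.+1).2 = (S - t) * (v j).2 + t * (v j.+1).2 ->
  [/\ j = i.+1, s = S & t = 0] \/ [/\ i = 0%N, j = m.-1, s = 0 & t = S].
Proof.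
move=> ij S0 sS tS e1 e2; have Sn := lt0r_neq0 S0.
have D (x : R) : 0 <= x <= S -> 0 <= x / S <= 1.
  by move=> /andP[x0 xS]; rewrite divr_ge0 ?(ltW S0) //= ler_pdivrMr ?mul1r.
have E (x a b : R) : (1 - x / S) * a + x / S * b = ((S - x) * a + x * b) / S.
  by field.
case: (edges_meet ij (D s sS) (D t tS)); rewrite ?E ?e1 ?e2 //.
  by move=> [-> /divr1_eq-> /eqP]; rewrite mulf_eq0 invr_eq0 (negPf Sn) orbF => /eqP->; left.
by move=> [-> -> /eqP + /divr1_eq->]; rewrite mulf_eq0 invr_eq0 (negPf Sn) orbF => /eqP->; right.
Qed.

(** A vanishing combination of these chords equates a point of edge [i] with one of edge [j]. The
    excluded pair is the one where the corner [u i j.+1] is [u 0 m], which is zero; in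
    [chord_tri_lower] the zero corner is [u i.+1 j] with [j = i.+1]. *)
Let chord_tri_upper (i j : nat) : (i < j < m)%N -> ~~ ((i == 0%N) && (j == m.-1)) ->
  tri_avoids0 (u i j) (u i j.+1) (u i.+1 j.+1).
Proof.
move=> ij nc x y z x0 y0 z0 s0; rewrite /u /= => e1 e2.
have [||||[_ ? ?]|[i0 jm _ _]] := @meet_scaled i j (x + y + z) z (y + z) ij s0;
  [lra|lra|lra|lra|lra|].
by move: nc; rewrite i0 jm !eqxx.
Qed.

Let chord_tri_lower (i j : nat) : (i < j < m)%N -> j != i.+1 ->
  tri_avoids0 (u i j) (u i.+1 j) (u i.+1 j.+1).
Proof.
move=> ij nc x y z x0 y0 z0 s0; rewrite /u /= => e1 e2.
have [||||[jm _ _]|[_ _ ? ?]] := @meet_scaled i j (x + y + z) (y + z) z ij s0;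
  [lra|lra|lra|lra| |lra].
by move: nc; rewrite jm eqxx.
Qed.

(** Crossings of the chord from [v i] while its far end runs along the polygon from [v i.+1] to
    [v m]. *)
Let row i := \big[addb/false]_(j < m - i.+1)
  sweeps l (u i (i.+1 + j)) (u i (i.+1 + j).+1).

Let left_opp j : (0 < j < m)%N -> right_half l (u j m) = false.
Proof.
move=> jm; have h := v0_extremal jm.
rewrite /u vm -opprB right_half_opp ?h //.
by apply: contraTneq h => ->; rewrite right_half0.
Qed.

(** The strip between two rows gets nothing from its far end, where both chords end at the extremal
    vertex and lie in the left half-plane. At its near end a triangle trades the first sides for the
    turn from one edge direction to the next. *)
Let row_step i : (0 < i)%N -> (i.+1 < m)%N ->
  row i = sweeps l (u i i.+1) (u i.+1 i.+2) (+) row i.+1.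
Proof.
move=> i0 im; rewrite /row.
have -> : (m - i.+1 = (m - i.+2).+1)%N by lia.
rewrite big_ord_recl /= addn0.
have e k : (i.+1 + bump 0 k = i.+2 + k)%N by rewrite /bump; lia.
under eq_bigr do rewrite e.
have := @sweeps_strip _ _ l_neq0 (fun j => u i (i.+2 + j)) (fun j => u i.+1 (i.+2 + j)) (m - i.+2).
rewrite /= !addn0 subnKC // (sweeps_same (a := u i m)); last first.
  by rewrite !left_opp //; lia.
rewrite addbF.
under eq_bigr do rewrite addnS.
under [in X in _ -> _ -> _ = _ (+) X]eq_bigr do rewrite addnS.
move=> ->; last 2 first.
- by move=> j jN; rewrite addnS; apply: chord_tri_upper; lia.
- by move=> j jN; rewrite addnS; apply: chord_tri_lower; lia.
rewrite addbA (sweeps_tri l_neq0) //; apply: chord_tri_upper; lia.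
Qed.

Let row1 : row 1 = \big[addb/false]_(1 <= i < m.-1) sweeps l (u i i.+1) (u i.+1 i.+2).
Proof.
suff H d : (d < m.-1)%N -> row (m.-1 - d) =
    \big[addb/false]_(m.-1 - d <= i < m.-1) sweeps l (u i i.+1) (u i.+1 i.+2).
  by have := H n.+1 (ltnSn _); rewrite subSn // subnn.
elim: d => [|d IH] dm.
  by rewrite subn0 big_geq // /row subnn big_ord0.
have E : (m.-1 - d = (m.-1 - d.+1).+1)%N by lia.
rewrite row_step; [|lia|lia].
rewrite -E IH; last lia.
by rewrite [in RHS]big_ltn -?E //; lia.
Qed.

(* Hopf's Umlaufsatz mod 2: the chords [v j - v i] fill a triangle whose diagonal
   side carries the directions of the edges; on its other two sides the chords
   issue from an extremal vertex and stay in a half-plane. *)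
Lemma polygon_sweeps_odd :
  \big[addb/false]_(i < m) sweeps l (v i.+1 - v i) (v i.+2 - v i.+1).
Proof.
have r0 j : (0 < j < m)%N -> right_half l (u 0%N j) = true by exact: v0_extremal.
have T2 : tri_avoids0 (u 0%N m.-1) (u 1%N m.-1) (u 1%N m) by apply: chord_tri_lower; lia.
(* The chord [u 0 m] is zero, so this corner of the triangle of chords is cut off along the segment
   from [u 0 m.-1] to [u 1 m]. *)
have top : sweeps l (u 0%N m.-1) (u 1%N m) = sweeps l (u 0%N 1%N) (u 1%N 2) (+) row 1.
  rewrite -(sweeps_tri l_neq0 T2).
  have := @sweeps_strip _ _ l_neq0 (fun j => u 0%N (2 + j)%N) (fun j => u 1%N (2 + j)%N) n.
  rewrite /= addn0 big1 ?addFb; last by move=> [j jn] _ /=; apply: sweeps_same; rewrite !r0 //; lia.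
  move=> ->; last 2 first.
  - by move=> j jN; rewrite addnS; apply: chord_tri_upper; lia.
  - by move=> j jN; rewrite addnS; apply: chord_tri_lower; lia.
  rewrite /row subSS subSS subn0 big_ord_recr /= -addbA.
  under [in LHS]eq_bigr do rewrite addnS.
  congr (_ (+) _); rewrite -(sweeps_tri l_neq0 (a := u 0%N 1%N) (b := u 0%N 2)).
    by rewrite (sweeps_same (a := u 0%N 1%N)) // !r0.
  by apply: chord_tri_upper; lia.
rewrite -(big_mkord xpredT (fun i => sweeps l (v i.+1 - v i) (v i.+2 - v i.+1))).
rewrite big_nat_recr //= big_ltn // -row1 -top vm1 vm.
(* The closing turn goes from [- u 0 m.-1] to [- u 1 m], the negative of the segment in [top].
   Exactly one of the two crosses the ray, which is the source of the oddness. *)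
have := tri_avoids0_swap (tri_avoids0_rot (tri_avoids0_rot (tri_avoids0_opp T2))).
rewrite /u vm !opprB => /(sweeps_opp l_neq0); rewrite !opprB addbC; apply; last exact: r0.
by have := left_opp (j := m.-1); rewrite /u vm; apply; lia.
Qed.
End Hopf.

(** * Polygons in a topological disk *)

Section RayParity.
Variables (R : realType) (l : R * R).
Hypothesis l_neq0 : l != 0.

Definition close (d : R) (x y : R * R) : Prop :=
  `|x.1 - y.1| < d /\ `|x.2 - y.2| < d.

Definition close_continuous (A : set (R * R)) (f : R * R -> R * R) : Prop :=
  forall x, A x -> forall eps : R, 0 < eps ->
  exists2 del : R, 0 < del & forall y, A y -> close del x y -> close eps (f x) (f y).

Lemma within_close_continuous (A : set (R * R)) (f : R * R -> R * R) :
  {within A, continuous f}%classic -> close_continuous A f.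
Proof.
move=> /subspace_continuousP cf x Ax eps eps0.
have /cvg_ballP/(_ eps eps0) := cf x Ax.
rewrite near_withinE => /nbhs_ballP[del /= del0 H]; exists del => // y Ay [xy1 xy2].
by have [] := H y (conj xy1 xy2) Ay.
Qed.

(** In a coordinate where [z] has absolute value at least [e], the three points all have the strict
    sign of [z]. *)
Lemma tri_avoids0_near (z a b d : R * R) (e : R) : e <= Num.max `|z.1| `|z.2| ->
  close e z a -> close e z b -> close e z d -> tri_avoids0 a b d.
Proof.
have near1 (s t : R) : e <= `|s| -> `|s - t| < e -> 0 < s * t.
  move=> es /lt_le_trans/(_ es) {es}; case: (ltrgt0P s) => [s0|s0|->]; last by rewrite ltNge normr_ge0.
    by rewrite ltr_distl => /andP[_ +]; rewrite pmulr_rgt0 //; lra.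
  by rewrite ltr_distl => /andP[+ _]; rewrite nmulr_rgt0 //; lra.
have key (s ta tb td : R) (x y w : R) : 0 < s * ta -> 0 < s * tb -> 0 < s * td ->
    0 <= x -> 0 <= y -> 0 <= w -> 0 < x + y + w -> x * ta + y * tb + w * td = 0 -> False.
  move=> ha hb hd x0 y0 w0 s0 eq0.
  have : x * (s * ta) + y * (s * tb) + w * (s * td) = 0.
    by rewrite -[RHS](mulr0 s) -eq0; ring.
  have xa := mulr_ge0 x0 (ltW ha); have yb := mulr_ge0 y0 (ltW hb).
  have wd := mulr_ge0 w0 (ltW hd).
  move=> e0; have [x1|x1] := eqVneq x 0; have [y1|y1] := eqVneq y 0.
  - have w1 : 0 < w by lra.
    by have := mulr_gt0 w1 hd; lra.
  - have : 0 < y by rewrite lt0r y1.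
    by move=> y2; have := mulr_gt0 y2 hb; lra.
  - have : 0 < x by rewrite lt0r x1.
    by move=> x2; have := mulr_gt0 x2 ha; lra.
  - have : 0 < x by rewrite lt0r x1.
    by move=> x2; have := mulr_gt0 x2 ha; lra.
rewrite le_max => /orP[hz|hz] [a1 a2] [b1 b2] [d1 d2] x y w x0 y0 w0 s0 e1 e2.
  exact: (key z.1 _ _ _ _ _ _ (near1 _ _ hz a1) (near1 _ _ hz b1) (near1 _ _ hz d1) x0 y0 w0 s0).
exact: (key z.2 _ _ _ _ _ _ (near1 _ _ hz a2) (near1 _ _ hz b2) (near1 _ _ hz d2) x0 y0 w0 s0).
Qed.

Definition unit_square : set (R * R) :=
  [set x | 0 <= x.1 <= 1 /\ 0 <= x.2 <= 1]%classic.

Lemma compact_unit_square : compact unit_square.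
Proof.
have -> : unit_square = (`[0, 1]%classic `*` `[0, 1]%classic)%classic.
  by apply/seteqP; split => x /=; rewrite !in_itv.
by apply: compact_setX; exact: segment_compact.
Qed.

(** A Lebesgue number argument: near each point [f] varies by less than the size of its value there,
    and compactness makes the mesh uniform. *)
Lemma unit_square_triangles (f : R * R -> R * R) :
  close_continuous unit_square f -> (forall x, unit_square x -> f x != 0) ->
  \forall N \near \oo%classic, forall x a b d,
    unit_square x -> unit_square a -> unit_square b -> unit_square d ->
    close N.+1%:R^-1 x a -> close N.+1%:R^-1 x b -> close N.+1%:R^-1 x d ->
    tri_avoids0 (f a) (f b) (f d).
Proof.
move=> cf f0.
have /compact_near_coveringP cK := compact_unit_square.
have := cK _ \oo%classic (fun N x => forall a b d,
  unit_square a -> unit_square b -> unit_square d ->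
  close N.+1%:R^-1 x a -> close N.+1%:R^-1 x b -> close N.+1%:R^-1 x d ->
  tri_avoids0 (f a) (f b) (f d)).
move=> /(_ _) H; apply: filterS (H _) => [N HN x a b d Kx|x Kx].
  exact: HN.
have fx : 0 < Num.max `|(f x).1| `|(f x).2|.
  rewrite lt_max !normr_gt0 -negb_and; exact: (f0 x Kx).
have [del del0 Hd] := cf x Kx _ fx.
have del2 : 0 < del / 2 by rewrite divr_gt0.
(* Half of [del] is spent on moving the base point, half on the mesh. *)
exists (ball x (del / 2), [set N | N.+1%:R^-1 < del / 2])%classic => /=.
  split; first exact: nbhsx_ballx.
  exact: (near_infty_natSinv_lt (interval_inference.PosNum del2)).
move=> [x' N] /= [[xx1 xx2] HN] a b d Ka Kb Kd da db dd.
have tr1 (s s' t : R) : `|s - s'| < del / 2 -> `|s' - t| < N.+1%:R^-1 -> `|s - t| < del.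
  move=> ss' s't; rewrite -(subrKA s') (le_lt_trans (ler_normD _ _)) //.
  by rewrite [ltRHS]splitr ltrD // (lt_trans s't).
have tr y : close N.+1%:R^-1 x' y -> close del x y.
  by move=> [y1 y2]; split; [exact: tr1 xx1 y1 | exact: tr1 xx2 y2].
by apply: (@tri_avoids0_near (f x) _ _ _ _ (lexx _)); apply: Hd => //; exact: tr.
Qed.

Definition column_parity (f : R * R -> R * R) (M : nat) (t : R) : bool :=
  \big[addb/false]_(a < M) sweeps l (f (a%:R / M%:R, t)) (f (a.+1%:R / M%:R, t)).

(** The boundary of a square mapped away from the origin crosses the ray an even number of times;
    the side where [f] is the constant [c] contributes nothing. *)
Lemma square_parity (f : R * R -> R * R) (c : R * R) :
  close_continuous unit_square f -> (forall x, unit_square x -> f x != 0) ->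
  (forall t, 0 <= t <= 1 -> f (1, t) = c) ->
  \forall N \near \oo%classic,
    \big[addb/false]_(b < N.+2)
      sweeps l (f (0, b%:R / N.+2%:R)) (f (0, b.+1%:R / N.+2%:R)) =
    column_parity f N.+2 0 (+) column_parity f N.+2 1.
Proof.
move=> cf f0 f1; apply: filterS (unit_square_triangles cf f0) => N H.
(* One more than [N.+1], since closeness requires a mesh strictly below [N.+1%:R^-1]. *)
pose M := N.+2; have M0 : 0 < M%:R :> R by rewrite ltr0n.
have in01 a : (a <= M)%N -> 0 <= (a%:R / M%:R : R) <= 1.
  by move=> aM; rewrite divr_ge0 ?ler0n //= ler_pdivrMr ?mul1r ?ler_nat.
have sqP a b : (a <= M)%N -> (b <= M)%N -> unit_square (a%:R / M%:R, b%:R / M%:R).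
  by move=> aM bM; split; exact: in01.
have step a : `|a%:R / M%:R - a.+1%:R / M%:R| < N.+1%:R^-1 :> R.
  rewrite -mulrBl -natr1 opprD addNKr mulN1r normrN gtr0_norm ?invr_gt0 //.
  by rewrite ltf_pV2 ?posrE ?ltr0n // ltr_nat.
have same a : `|a - a| < N.+1%:R^-1 :> R by rewrite subrr normr0 invr_gt0 ltr0n.
have strip b : (b < M)%N ->
    sweeps l (f (0, b%:R / M%:R)) (f (0, b.+1%:R / M%:R)) =
    column_parity f M (b%:R / M%:R) (+) column_parity f M (b.+1%:R / M%:R).
  move=> bM.
  have := @sweeps_strip _ _ l_neq0 (fun a => f (a%:R / M%:R, b%:R / M%:R))
    (fun a => f (a%:R / M%:R, b.+1%:R / M%:R)) M.
  rewrite mul0r divff ?lt0r_neq0 // !f1 ?in01 ?(ltnW bM) // (sweeps_same (erefl (right_half l c))) addbF.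
  rewrite -/(column_parity f M _) -/(column_parity f M _) => ->.
  - by rewrite -addbA addbb addbF.
  - move=> a aM; apply: (H (a%:R / M%:R, b%:R / M%:R));
      by [apply: sqP => //; exact: ltnW | split; rewrite /= ?step ?same].
  - move=> a aM; apply: (H (a%:R / M%:R, b%:R / M%:R));
      by [apply: sqP => //; exact: ltnW | split; rewrite /= ?step ?same].
have tele K : (K <= M)%N -> \big[addb/false]_(b < K)
      sweeps l (f (0, b%:R / M%:R)) (f (0, b.+1%:R / M%:R)) =
    column_parity f M 0 (+) column_parity f M (K%:R / M%:R).
  elim: K => [_|K IH KM]; first by rewrite big_ord0 mul0r addbb.
  by rewrite big_ord_recr /= IH 1?ltnW // strip // addbA -(addbA (column_parity f M 0)) addbb addbF.
by rewrite tele // divff // lt0r_neq0.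
Qed.

Lemma line1 (x y : R * R) (t : R) : (x + t *: (y - x)).1 = x.1 + t * (y.1 - x.1).
Proof. by []. Qed.

Lemma line2 (x y : R * R) (t : R) : (x + t *: (y - x)).2 = x.2 + t * (y.2 - x.2).
Proof. by []. Qed.

(** Points of one segment span degenerate triangles that still miss the origin, so the cocycle rule
    telescopes along a subdivision. *)
Lemma segment_sweeps (x y : R * R) (M : nat) :
  (forall t : R, 0 <= t <= 1 -> x + t *: (y - x) != 0) ->
  \big[addb/false]_(b < M.+1)
    sweeps l (x + (b%:R / M.+1%:R) *: (y - x)) (x + (b.+1%:R / M.+1%:R) *: (y - x)) =
  sweeps l x y.
Proof.
move=> xy.
have M0 : 0 < M.+1%:R :> R by rewrite ltr0n.
have in01 a : (a <= M.+1)%N -> 0 <= (a%:R / M.+1%:R : R) <= 1.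
  by move=> aM; rewrite divr_ge0 ?ler0n //= ler_pdivrMr ?mul1r ?ler_nat.
pose g (t : R) := x + t *: (y - x); rewrite -/(g _).
have gt (r s t : R) : 0 <= r <= 1 -> 0 <= s <= 1 -> 0 <= t <= 1 -> tri_avoids0 (g r) (g s) (g t).
  move=> /andP[r0 r1] /andP[s0 s1] /andP[t0 t1] a b d a0 b0 d0 S0 e1 e2.
  have hS : 0 <= (a * r + b * s + d * t) / (a + b + d) <= 1.
    rewrite divr_ge0 ?(ltW S0) ?addr_ge0 ?mulr_ge0 //= ler_pdivrMr // mul1r.
    by rewrite !lerD // ler_piMr.
  move/negP: (xy _ hS); apply; have Sn := lt0r_neq0 S0.
  apply/andP; split; apply/eqP; rewrite ?line1 ?line2.
    by rewrite -[RHS](mul0r (a + b + d)^-1) -e1 /g !line1; field.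
  by rewrite -[RHS](mul0r (a + b + d)^-1) -e2 /g !line2; field.
have tele K : (K <= M.+1)%N -> \big[addb/false]_(b < K)
    sweeps l (g (b%:R / M.+1%:R)) (g (b.+1%:R / M.+1%:R)) = sweeps l (g 0) (g (K%:R / M.+1%:R)).
  elim: K => [_|K IH KM]; first by rewrite big_ord0 mul0r sweeps_same.
  rewrite big_ord_recr /= IH 1?ltnW // (sweeps_tri l_neq0) //.
  by apply: gt; rewrite ?lexx ?ler01 ?in01 // ltnW.
rewrite [LHS](tele M.+1 (leqnn _)) divff ?lt0r_neq0 // /g scale0r addr0 scale1r.
by rewrite addrC subrK.
Qed.

Lemma unit_disk_coord (z : R * R) : unit_disk z -> `|z.1| <= 1 /\ `|z.2| <= 1.
Proof.
rewrite /unit_disk /= => zD.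
by split; rewrite -[_ <= 1](@ler_pXn2r _ 2) ?nnegrE // expr1n real_normK ?num_real //;
  apply: le_trans zD; rewrite ?lerDl ?lerDr sqr_ge0.
Qed.

Lemma unit_disk_scale (z : R * R) (r : R) : 0 <= r <= 1 -> unit_disk z -> unit_disk (r *: z).
Proof.
move=> /andP[r0 r1]; rewrite /unit_disk /= /GRing.scale /= !exprMn -mulrDr => zD.
apply: le_trans zD; rewrite ler_piMl ?addr_ge0 ?sqr_ge0 //.
by rewrite exprn_ile1.
Qed.

Lemma dinvK (D : disk R) z : disk_set D z -> dmap D (dinv D z) = z.
Proof. by move=> [w wD <-]; rewrite dmapK. Qed.

Lemma dinv_unit_disk (D : disk R) z : disk_set D z -> unit_disk (dinv D z).
Proof. by move=> [w wD <-]; rewrite dmapK. Qed.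

(* Contracting the disk radially to its centre keeps every point other than [p]
   away from the boundary point [p]. *)
Definition contraction (D : disk R) (p z : R * R) (s : R) : R * R :=
  dmap D ((1 - s) *: dinv D z) - p.

Lemma contraction_neq0 (D : disk R) (p z : R * R) (s : R) :
  disk_boundary D p -> disk_set D z -> z <> p -> 0 <= s <= 1 ->
  contraction D p z s != 0.
Proof.
move=> [u u1 <-] Dz zp /andP[s0 s1]; have wD := dinv_unit_disk Dz.
have uD : unit_disk u by rewrite /unit_disk /= u1.
rewrite subr_eq0; apply/eqP => e.
have {}e : (1 - s) *: dinv D z = u.
  by rewrite -(@dmapK _ D _ uD) -e dmapK //; apply: unit_disk_scale => //; rewrite subr_ge0 s1 lerBlDr lerDl.
have [q0 q1] : 0 <= (dinv D z).1 ^+ 2 + (dinv D z).2 ^+ 2 /\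
    (dinv D z).1 ^+ 2 + (dinv D z).2 ^+ 2 <= 1.
  by split; [rewrite addr_ge0 ?sqr_ge0 | exact: wD].
move: u1; rewrite /unit_circle /= -e /GRing.scale /= !exprMn -mulrDr.
move: (_ + _ : R) q0 q1 => q q0 q1 e1.
have s00 : s = 0.
  have h1 : (1 - s) ^+ 2 * q <= (1 - s) ^+ 2 by rewrite ler_piMr ?sqr_ge0.
  have h2 : (1 - s) ^+ 2 <= 1 - s by rewrite expr2 ler_piMl ?subr_ge0 // lerBlDr lerDl.
  by apply/eqP; rewrite eq_le s0 andbT; move: (le_trans h1 h2); rewrite e1 lerBrDr gerDl.
by apply: zp; rewrite -(dinvK Dz) -e s00 subr0 scale1r.
Qed.

Lemma contraction_close_continuous (D : disk R) (p x y : R * R) :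
  (forall z, on_segment x y z -> disk_set D z) ->
  close_continuous unit_square
    (fun st => contraction D p (x + st.2 *: (y - x)) st.1).
Proof.
move=> xyD [s t] [/= /andP[s0 s1] t01] eps eps0.
have segD (r : R) : 0 <= r <= 1 -> disk_set D (x + r *: (y - x)).
  by move=> r01; apply: xyD; exists r.
have qD (r : R * R) : unit_square r -> unit_disk ((1 - r.1) *: dinv D (x + r.2 *: (y - x))).
  by case=> r1 r2; apply: unit_disk_scale; [lra | exact: dinv_unit_disk (segD _ r2)].
have [d1 d10 H1] := within_close_continuous (@dmap_continuous _ D) (qD (s, t) (conj (introT andP (conj s0 s1)) t01)) eps0.
have d12 : 0 < d1 / 2 by rewrite divr_gt0.
have [d2 d20 H2] := within_close_continuous (@dinv_continuous _ D) (segD t t01) d12.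
(* A positive bound on the speed of the segment in each coordinate. *)
pose L := 1 + `|y.1 - x.1| + `|y.2 - x.2|.
have L0 : 0 < L by rewrite !ltr_wpDr.
exists (Num.min (d1 / 2) (d2 / L)); first by rewrite lt_min d12 divr_gt0.
move=> [s' t'] st' [/= cs ct]; have [/= s'01 t'01] := st'.
have [ax1 ax2] : close (d1 / 2) (dinv D (x + t *: (y - x))) (dinv D (x + t' *: (y - x))).
  apply: H2; first exact: segD.
  move: ct; rewrite lt_min => /andP[_]; rewrite ltr_pdivlMr // => ct.
  have aux (a b : R) : `|b| <= L -> `|a + t * b - (a + t' * b)| < d2.
    move=> bL; rewrite opprD addrACA subrr add0r -mulrBl normrM.
    by apply: le_lt_trans ct; rewrite ler_wpM2l.
  split; rewrite ?line1 ?line2; apply: aux; rewrite /L.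
    by have := normr_ge0 (y.2 - x.2); lra.
  by have := normr_ge0 (y.1 - x.1); lra.
have [b1 b2] := unit_disk_coord (dinv_unit_disk (segD t' t'01)).
have cs2 : `|s - s'| < d1 / 2 by move: cs; rewrite lt_min => /andP[].
have aux (a a' : R) : `|a - a'| < d1 / 2 -> `|a'| <= 1 ->
    `|(1 - s) * a - (1 - s') * a'| < d1.
  move=> h1 h2.
  rewrite (_ : _ - _ = (1 - s) * (a - a') + (s' - s) * a'); last by ring.
  rewrite (le_lt_trans (ler_normD _ _)) // [ltRHS]splitr ltr_leD // !normrM.
    by rewrite (le_lt_trans _ h1) // ler_piMl // ger0_norm; lra.
  by rewrite distrC (le_trans _ (ltW cs2)) // ler_piMr.
have [] := H1 _ (qD (s', t') st') (conj (aux _ _ ax1 b1) (aux _ _ ax2 b2)).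
rewrite /contraction /= => f1 f2.
have sub (a b c : R) : a - c - (b - c) = a - b by ring.
by split; rewrite /= sub.
Qed.

Definition contraction_parity (D : disk R) (p z : R * R) (M : nat) : bool :=
  \big[addb/false]_(a < M)
    sweeps l (contraction D p z (a%:R / M%:R)) (contraction D p z (a.+1%:R / M%:R)).

(** The square has the position on the segment as second coordinate and the contraction time as
    first. At time 1 every point is at the image of the centre, so the crossing of the segment is
    the sum mod 2 of those of the contraction paths of its end points. *)
Lemma segment_contraction_parity (D : disk R) (p x y : R * R) :
  disk_boundary D p -> (forall z, on_segment x y z -> disk_set D z /\ z <> p) ->
  \forall N \near \oo%classic, sweeps l (x - p) (y - p) =
    contraction_parity D p x N.+2 (+) contraction_parity D p y N.+2.
Proof.
move=> pD xyD.
have seg (t : R) : 0 <= t <= 1 -> on_segment x y (x + t *: (y - x)) by exists t.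
pose f (st : R * R) := contraction D p (x + st.2 *: (y - x)) st.1.
have cf : close_continuous unit_square f.
  by apply: contraction_close_continuous => z /xyD[].
have f0 (st : R * R) : unit_square st -> f st != 0.
  by move=> [s01 t01]; have [Dz zp] := xyD _ (seg _ t01); apply: contraction_neq0.
have f1 t : 0 <= t <= 1 -> f (1, t) = dmap D 0 - p.
  by move=> _; rewrite /f /contraction subrr scale0r.
apply: filterS (square_parity cf f0 f1) => N.
have f00 t : 0 <= t <= 1 -> f (0, t) = (x - p) + t *: ((y - p) - (x - p)).
  move=> t01; rewrite /f /contraction subr0 scale1r dinvK; last by have [] := xyD _ (seg _ t01).
  by rewrite /= addrAC opprB addrA subrK.
have e (z : R * R) t : x + t *: (y - x) = z ->
    column_parity f N.+2 t = contraction_parity D p z N.+2.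
  by move=> <-; apply: eq_bigr.
rewrite (e x 0) ?scale0r ?addr0 // (e y 1); last by rewrite scale1r addrC subrK.
move=> <-.
rewrite -(@segment_sweeps (x - p) (y - p) N.+1) => [|t t01]; last first.
  by rewrite -f00 //; apply: f0; split; rewrite /= ?lexx ?ler01.
by apply: eq_bigr => b _; rewrite !f00 // divr_ge0 ?ler0n //= ler_pdivrMr ?ltr0n // mul1r ler_nat // ltnW.
Qed.

(** For a subdivision fine enough for all the edges at once, the parity of the contraction path is a
    potential on the vertices, and its differences cancel around a closed polygon. *)
Lemma polygon_ray_parity (D : disk R) (p : R * R) (m : nat) (v : nat -> R * R) :
  disk_boundary D p -> v m = v 0%N ->
  (forall i, (i < m)%N -> forall z, on_segment (v i) (v i.+1) z -> disk_set D z /\ z <> p) ->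
  \big[addb/false]_(i < m) sweeps l (v i - p) (v i.+1 - p) = false.
Proof.
move=> pD vm H.
have : \forall N \near \oo%classic, forall i, (i < m)%N -> sweeps l (v i - p) (v i.+1 - p) =
    contraction_parity D p (v i) N.+2 (+) contraction_parity D p (v i.+1) N.+2.
  elim: {-2}m (leqnn m) => [|k IH] km; first by apply: nearW.
  have := segment_contraction_parity pD (H k km).
  apply: filterS2 (IH (ltnW km)) => N HN1 HN2 i.
  by rewrite ltnS leq_eqVlt => /orP[/eqP->|/HN1].
move=> /filter_ex [N HN].
have tele k : (k <= m)%N -> \big[addb/false]_(i < k) sweeps l (v i - p) (v i.+1 - p) =
    contraction_parity D p (v 0%N) N.+2 (+) contraction_parity D p (v k) N.+2.
  elim: k => [_|k IH km]; first by rewrite big_ord0 addbb.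
  rewrite big_ord_recr /= IH 1?ltnW // HN // addbA.
  by rewrite -(addbA (contraction_parity _ _ _ _)) addbb addbF.
by rewrite tele // vm addbb.
Qed.


End RayParity.

(** * Turns and ray intersections in terms of [sweeps] *)

Section RayHit.
Variables (R : realType) (l : R * R).

(** The index of a turn is [1] or [-1] exactly when [l] lies strictly inside the angle swept; modulo
    2 its sign is lost. *)
Lemma turn_wind_sweeps (u v : R * R) : cross u l != 0 -> cross v l != 0 ->
  odd `|turn_wind l u v| = sweeps l u v.
Proof.
move=> u0 v0; rewrite /turn_wind /orient /sweeps /right_half (negPf u0) (negPf v0) /= !orbF.
have -> : cross l v = - cross v l by rewrite /cross; ring.
have -> : cross v u = - cross u v by rewrite /cross; ring.
rewrite sgzN.
by case: (sgzP (cross u l)) u0 => // _ _; case: (sgzP (cross v l)) v0 => // _ _;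
  rewrite /= ?oppr_gt0; case: (sgzP (cross u v)).
Qed.

(** The segment is not parallel to the ray and its end points are off it, so any intersection is a
    transversal crossing. *)
Lemma ray_hit_sweeps (p x y : R * R) :
  cross (y - x) l != 0 ->
  (forall t, 0 <= t -> x <> p + t *: l) -> (forall t, 0 <= t -> y <> p + t *: l) ->
  (forall z, on_segment x y z -> z <> p) ->
  (exists z, [/\ on_segment x y z, exists2 t : R, 0 <= t & z = p + t *: l & z <> p]) <->
  sweeps l (x - p) (y - p).
Proof.
move=> yx xr yr nop.
have cE : cross (y - x) l = cross (y - p) l - cross (x - p) l by rewrite /cross /=; ring.
rewrite cE subr_eq0 in yx.
have pointE (t s : R) : x + t *: (y - x) = p + s *: l <->
    ((1 - t) * (x - p).1 + t * (y - p).1 = s * l.1 /\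
     (1 - t) * (x - p).2 + t * (y - p).2 = s * l.2).
  split => [e|[e1 e2]].
    have := congr1 fst e; have := congr1 snd e; rewrite /= /GRing.scale /= => e2 e1.
    by split; lra.
  rewrite [LHS]surjective_pairing [RHS]surjective_pairing /= /GRing.scale /=.
  by congr (_, _); move: e1 e2 => /=; lra.
have noray0 (a : R * R) : a = x \/ a = y -> forall s, 0 <= s -> (a - p).1 = s * l.1 -> (a - p).2 = s * l.2 -> False.
  move=> ha s s0 e1 e2; have : a = p + s *: l.
    rewrite [LHS]surjective_pairing [RHS]surjective_pairing /= /GRing.scale /= -e1 -e2 /=.
    by congr (_, _); ring.
  by case: ha => ->; [exact: xr | exact: yr].
have seg t : 0 <= t <= 1 -> on_segment x y (x + t *: (y - x)) by exists t.
move: (x - p) (y - p) yx pointE cE (noray0 x (or_introl erefl)) (noray0 y (or_intror erefl)).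
move=> a d ad pointE cE xray yray; split.
  move=> [z [[t [t01 ->]] [s s0 /pointE[e1 e2]] zp]].
  have sn : s != 0.
    apply: contra_notN zp => /eqP s00; have [_ ->] := pointE t s; last by [].
    by rewrite s00 scale0r addr0.
  have sp : 0 < s by rewrite lt0r sn.
  have E0 : (1 - t) * cross a l + t * cross d l = 0.
    rewrite (_ : _ + _ = ((1 - t) * a.1 + t * d.1) * l.2 - ((1 - t) * a.2 + t * d.2) * l.1).
      by rewrite e1 e2; ring.
    by rewrite /cross; ring.
  have E1 : t * cross a d = s * cross a l.
    rewrite (_ : t * _ = a.1 * ((1 - t) * a.2 + t * d.2) - a.2 * ((1 - t) * a.1 + t * d.1)).
      by rewrite e1 e2 /cross; ring.
    by rewrite /cross; ring.
  have E2 : (1 - t) * cross d a = s * cross d l.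
    rewrite (_ : (1 - t) * _ = d.1 * ((1 - t) * a.2 + t * d.2) - d.2 * ((1 - t) * a.1 + t * d.1)).
      by rewrite e1 e2 /cross; ring.
    by rewrite /cross; ring.
  have t1 : t != 1.
    apply/eqP => tt; rewrite tt in e1 e2.
    by apply: (yray s s0); lra.
  have t0 : t != 0.
    apply/eqP => tt; rewrite tt in e1 e2.
    by apply: (xray s s0); lra.
  move/andP: t01 => [tge tle].
  have {t0 tge} tp : 0 < t by rewrite lt0r t0.
  have {t1 tle} tl : 0 < 1 - t by rewrite subr_gt0 lt_neqAle t1.
  rewrite /sweeps /right_half.
  case: (ltrgt0P (cross a l)) => [xa|xa|xa] /=.
  - have xd : cross d l < 0.
      rewrite -(pmulr_rlt0 _ tp); have := mulr_gt0 tl xa; lra.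
    rewrite ltNge (ltW xd) (lt_eqF xd) /=.
    by rewrite -(pmulr_rgt0 _ tp) E1 mulr_gt0.
  - have xd : 0 < cross d l.
      rewrite -(pmulr_rgt0 _ tp); have : (1 - t) * cross a l < 0 by rewrite pmulr_rlt0.
      lra.
    by rewrite xd /= -(pmulr_rgt0 _ tl) E2 mulr_gt0.
  - move/eqP: E0; rewrite xa mulr0 add0r mulf_eq0 gt_eqF //= => /eqP xd.
    by rewrite xa xd eqxx in ad.
move=> /andP[hh].
(* By Cramer's rule the lines meet at parameter [cross a l / S] on the segment and [cross a d / S]
   on the ray. *)
have build : cross a l != cross d l ->
  forall S, S = cross a l - cross d l -> 0 <= cross a l / S <= 1 -> 0 < cross a d / S ->
  exists z, [/\ on_segment x y z, exists2 t : R, 0 <= t & z = p + t *: l & z <> p].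
  move=> ne S SE t01 s0; have Sn : S != 0 by rewrite SE subr_eq0.
  have e : x + (cross a l / S) *: (y - x) = p + (cross a d / S) *: l.
    apply/pointE; split.
      rewrite (_ : 1 - _ = - cross d l / S); last by rewrite SE; field; rewrite -SE.
      by rewrite /cross; field.
    rewrite (_ : 1 - _ = - cross d l / S); last by rewrite SE; field; rewrite -SE.
    by rewrite /cross; field.
  exists (x + (cross a l / S) *: (y - x)); split; first exact: seg.
    by exists (cross a d / S); [exact: ltW | exact: e].
  exact: nop (seg _ t01).
have ne : cross a l != cross d l by rewrite eq_sym.
case ha: (right_half l a) hh => hd.
  move=> c0; have xa := right_half_ge0 ha.
  have xd : cross d l <= 0 by apply: left_half_le0; case: right_half hd.
  have S0 : 0 < cross a l - cross d l by rewrite lt0r subr_eq0 ne subr_ge0 (le_trans xd).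
  apply: (build ne _ erefl); last exact: divr_gt0.
  by rewrite divr_ge0 ?(ltW S0) //= ler_pdivrMr // mul1r lerDl oppr_ge0.
move=> c0; have xa := left_half_le0 ha.
have xd : 0 <= cross d l by apply: right_half_ge0; case: right_half hd.
have S0 : cross a l - cross d l < 0.
  by rewrite lt_neqAle subr_eq0 ne subr_le0 (le_trans xa).
have cn : cross a d < 0.
  by rewrite (_ : cross a d = - cross d a) ?oppr_lt0 // /cross; ring.
apply: (build ne _ erefl); last by rewrite -mulrNN -invrN divr_gt0 // oppr_gt0.
by rewrite -mulrNN -invrN divr_ge0 ?oppr_ge0 ?(ltW S0) //= ler_pdivrMr ?oppr_gt0 // mul1r lerN2 gerBl.
Qed.

End RayHit.

(** * Cycles of a plabic graph *)

Lemma lex_min (R : realType) (l : R * R) (T : eqType) (s : seq T) (p : T -> R * R) :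
  l != 0 -> s != [::] ->
  exists2 x, x \in s & forall y, y \in s -> p y = p x \/ right_half l (p y - p x).
Proof.
move=> l0; elim: s => // a s IH _; have [->|/IH[x xs H]] := eqVneq s [::].
  by exists a; rewrite ?mem_head // => y; rewrite inE => /eqP->; left.
have [ax|[ax|/subr0_eq ax]] := right_half_lex l0 (p a - p x).
- exists x; first by rewrite inE xs orbT.
  by move=> y; rewrite inE => /orP[/eqP->|/H]; [right|].
- exists a; first exact: mem_head.
  move=> y; rewrite inE => /orP[/eqP->|/H[->|yx]]; [by left | by right; rewrite -opprB|].
  by right; rewrite -(subrKA (p x)) right_halfD // -opprB.
- exists x; first by rewrite inE xs orbT.
  by move=> y; rewrite inE => /orP[/eqP->|/H]; [left|].
Qed.

Lemma segment_point_eq (R : realType) (x y x' y' : R * R) (s t : R) :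
  (1 - s) * x.1 + s * y.1 = (1 - t) * x'.1 + t * y'.1 ->
  (1 - s) * x.2 + s * y.2 = (1 - t) * x'.2 + t * y'.2 ->
  x + s *: (y - x) = x' + t *: (y' - x').
Proof.
move=> e1 e2; rewrite [LHS]surjective_pairing [RHS]surjective_pairing !line1 !line2.
by congr (_, _); lra.
Qed.

Lemma odd_sum (I : Type) (r : seq I) (P : pred I) (F : I -> nat) :
  odd (\sum_(i <- r | P i) F i) = \big[addb/false]_(i <- r | P i) odd (F i).
Proof. exact: (big_morph odd oddD). Qed.

Section Cycles.
Variables (R : realType) (n k : nat) (G : drawing R n).
Hypothesis hG : plabic G k.
Local Notation edge := 'I_(ne G).
Local Notation vertex := ('I_n + 'I_(nv G))%type.

(** The form in which the colours enter: edges cannot both merge and split at one vertex. *)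
Lemma internal_in_out (v : 'I_(nv G)) :
  (#|in_edges (inr v : vertex)| <= 1)%N \/ (#|out_edges (inr v : vertex)| <= 1)%N.
Proof.
by have [/(white_indeg1 hG)|/(black_outdeg1 hG)] := boolP (white v);
  rewrite /indeg /outdeg => ->; [left | right].
Qed.

Lemma boundary_in_out (b : 'I_n) (f g : edge) : Defs.head f = inl b -> tail g = inl b -> False.
Proof.
move=> hf tg; have := boundary_deg1 hG b; rewrite /indeg /outdeg.
have : (0 < #|in_edges (inl b : vertex)|)%N by apply/card_gt0P; exists f; rewrite inE hf.
have : (0 < #|out_edges (inl b : vertex)|)%N by apply/card_gt0P; exists g; rewrite inE tg.
by lia.
Qed.

Lemma follows_irrefl (f : edge) : follows f f = false.
Proof. by rewrite /follows eq_sym; apply/negbTE; exact: (edge_nondegenerate hG). Qed.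

Lemma follows_internal (f g : edge) : follows f g -> ~~ is_boundary (Defs.head f).
Proof.
move=> /eqP fg; case hf: (Defs.head f) => [b|//].
by case: (boundary_in_out hf (etrans (esym fg) hf)).
Qed.

Lemma incident_pos (v : vertex) (f : edge) : incident v f ->
  on_edge f (pos v).
Proof.
case/orP => /eqP <-.
  by exists 0; rewrite lexx ler01; split=> //; rewrite scale0r addr0.
by exists 1; rewrite lexx ler01; split=> //; rewrite scale1r addrC subrK.
Qed.

(** Planarity compares two edges, so the edge attached to [b] is brought in as the second one. *)
Lemma internal_not_boundary_point (f : edge) (b : 'I_n) z :
  internal_edge f -> on_edge f z -> z <> pos (inl b : vertex).
Proof.
move=> fi fz zb.
have [g ig] : exists g : edge, incident (inl b) g.
  have : (0 < indeg (inl b : vertex) + outdeg (inl b : vertex))%N.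
    by rewrite (boundary_deg1 hG).
  rewrite addn_gt0 => /orP[]/card_gt0P[g]; rewrite inE => gb; exists g;
    by rewrite /incident gb ?orbT.
have notin (h : edge) : incident (inl b) h -> internal_edge h = false.
  by case/orP => /eqP hb; rewrite /internal_edge hb ?andbF.
have fg : f != g by apply: contraTneq fi => ->; rewrite notin.
have [] := planar hG fg fz; first by rewrite zb; exact: incident_pos.
move=> v [zv vf _]; have vb : v = inl b by apply: (pos_inj hG); rewrite -zv.
by move: fi; rewrite notin // -vb.
Qed.

Lemma boundary_vertex_on_boundary (b : 'I_n) :
  disk_boundary (in_disk G) (pos (inl b : vertex)).
Proof.
have [p [q [t [[_ pq _] tb _]]]] := boundary_on_interval hG.
by apply: pq; exists (t b); have [] := tb b.
Qed.

Section OneCycle.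
Variables (l : R * R) (hl : gauge_direction G l).
Variables (c : seq edge) (e0 : edge).
Hypotheses (c0 : c != [::]) (c_uniq : uniq c) (c_cycle : path.cycle (@follows R n G) c).

Local Notation m := (size c).
Let e i := nth e0 c (i %% m).
Let m_gt0 : (0 < m)%N. Proof. by rewrite lt0n size_eq0. Qed.
Let e_mem i : e i \in c. Proof. by rewrite mem_nth // ltn_pmod. Qed.

Let next_e i : next c (e i) = e i.+1.
Proof.
rewrite next_nth e_mem /e; case: c m_gt0 c_uniq i => // a s _ cu i.
rewrite index_uniq // ?ltn_pmod //.
have im : (i %% (size s).+1 < (size s).+1)%N by rewrite ltn_pmod.
have -> : (i.+1 %% (size s).+1 = (i %% (size s).+1).+1 %% (size s).+1)%N.
  by rewrite -addn1 -modnDml addn1.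
have [->|ne] := eqVneq (i %% (size s).+1)%N (size s).
  by rewrite modnn /= nth_default.
rewrite [((_ %% _).+1 %% _)%N]modn_small /=; last by rewrite ltnS ltn_neqAle ne -ltnS.
by apply: set_nth_default; rewrite ltn_neqAle ne -ltnS.
Qed.

Let follows_next f : f \in c -> follows f (next c f).
Proof. exact: next_cycle. Qed.

Let head_e i : Defs.head (e i) = tail (e i.+1).
Proof. by rewrite -next_e; apply/eqP; exact: follows_next. Qed.

Let c_internal f : f \in c -> internal_edge f.
Proof.
move=> fc; rewrite /internal_edge (follows_internal (follows_next fc)) andbT.
have := follows_next (f := prev c f); rewrite mem_prev next_prev // => /(_ fc) pf.
by rewrite -(eqP pf); exact: (follows_internal pf).
Qed.

(** An edge-simple cycle is vertex-simple: a vertex visited twice would have two incoming and two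
    outgoing edges. *)
Let tail_inj : {in c &, injective (@tail R n G)}.
Proof.
move=> f g fc gc tfg; apply/eqP/negPn/negP => fg.
have pf : Defs.head (prev c f) = tail f.
  by apply/eqP; have := follows_next (f := prev c f); rewrite mem_prev next_prev //; apply.
have pg : Defs.head (prev c g) = tail f.
  by rewrite tfg; apply/eqP; have := follows_next (f := prev c g); rewrite mem_prev next_prev //; apply.
have pfg : prev c f != prev c g.
  by apply: contra_neq fg => h; rewrite -(next_prev c_uniq f) h next_prev.
have := c_internal fc; rewrite /internal_edge; case tf: (tail f) => [//|v] _.
case: (internal_in_out v); rewrite leqNgt => /negP; apply; apply/card_gt1P.
  by exists (prev c f), (prev c g); rewrite !inE pf pg tf eqxx.
by exists f, g; rewrite !inE -tfg tf eqxx.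
Qed.

Let tail_e_inj i j : tail (e i) = tail (e j) -> (i = j %[mod m])%N.
Proof.
move=> /tail_inj; rewrite !e_mem => /(_ isT isT)/eqP.
by rewrite /e nth_uniq ?ltn_pmod // => /eqP.
Qed.

Let v i := pos (tail (e i)).
Let on_edge_e i z : on_edge (e i) z = on_segment (v i) (v i.+1) z.
Proof. by rewrite /on_edge head_e. Qed.
Let dir_e i : edge_dir (e i) = v i.+1 - v i.
Proof. by rewrite /edge_dir head_e. Qed.

Let v_neq i : v i != v i.+1.
Proof.
by apply/eqP => /(pos_inj hG); rewrite -head_e; apply/eqP; exact: (edge_nondegenerate hG).
Qed.

Let on_segment_scale (x y z : R * R) (s : R) : x != y -> x + s *: (y - x) = z ->
  (z = x -> s = 0) /\ (z = y -> s = 1).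
Proof.
move=> xy <-; split=> [/eqP|].
  by rewrite addrC -subr_eq0 addrK scaler_eq0 subr_eq0 (eq_sym y) (negPf xy) orbF => /eqP.
rewrite -[in RHS](subrK x y) [in RHS]addrC => /addrI.
rewrite -{2}[y - x]scale1r => /eqP; rewrite -subr_eq0 -scalerBl scaler_eq0.
by rewrite (subr_eq0 y) (eq_sym y) (negPf xy) orbF subr_eq0 => /eqP.
Qed.

Let e_neq i j : (i < j < m)%N -> e i != e j.
Proof.
move=> ij; rewrite /e nth_uniq ?ltn_pmod // !modn_small; [|lia|lia].
by lia.
Qed.

Let meet_vertex i j z : (i < j < m)%N -> on_edge (e i) z -> on_edge (e j) z ->
  (z = v i \/ z = v i.+1) /\ (z = v j \/ z = v j.+1).
Proof.
move=> ij zi zj; have [w [-> wi wj]] := planar hG (e_neq ij) zi zj.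
split; [move: wi|move: wj]; rewrite /incident head_e => /orP[]/eqP<-;
  by [left|right].
Qed.

Let mod_lt i j : (i < m)%N -> (j < m)%N -> v i = v j -> i = j.
Proof.
by move=> im jm /(pos_inj hG)/tail_e_inj; rewrite !modn_small.
Qed.

Let v_mod i : v (i %% m)%N = v i.
Proof. by rewrite /v /e modn_mod. Qed.

Let vm : v m = v 0%N.
Proof. by rewrite -v_mod modnn. Qed.

(** Straight edges exclude cycles of length two, whose edges would share their midpoint. *)
Let cycle_size : (3 <= m)%N.
Proof.
case E: m m_gt0 => [//|[|[|//]]] _.
  by have := v_neq 0; rewrite -[v 1]v_mod E eqxx.
have h0 : 0 <= (2^-1 : R) <= 1 by lra.
have half_neq : (2^-1 : R) <> 0 /\ (2^-1 : R) <> 1 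
  by split; apply/eqP; rewrite ?invr_eq0 ?invr_eq1 ?pnatr_eq0 ?pnatr_eq1.
have vz : v 2 = v 0%N by rewrite -vm E.
pose z := v 0%N + 2^-1 *: (v 1%N - v 0%N).
have z0 : on_edge (e 0) z by rewrite on_edge_e; exists 2^-1.
have z1 : on_edge (e 1) z.
  by rewrite on_edge_e vz; exists 2^-1; split=> //; apply: segment_point_eq; lra.
have [hz0 hz1] := on_segment_scale (v_neq 0) (erefl z).
have [|[/hz0 h|/hz1 h] _] := @meet_vertex 0 1 z _ z0 z1; first by rewrite E.
  by case: half_neq.
by case: half_neq.
Qed.

Let edges_meet (i j : nat) (s t : R) : (i < j < m)%N -> 0 <= s <= 1 -> 0 <= t <= 1 ->
  (1 - s) * (v i).1 + s * (v i.+1).1 = (1 - t) * (v j).1 + t * (v j.+1).1 ->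
  (1 - s) * (v i).2 + s * (v i.+1).2 = (1 - t) * (v j).2 + t * (v j.+1).2 ->
  [/\ j = i.+1, s = 1 & t = 0] \/ [/\ i = 0%N, j = m.-1, s = 0 & t = 1].
Proof.
move=> ij s01 t01 e1 e2.
pose z := v i + s *: (v i.+1 - v i).
have zE : v j + t *: (v j.+1 - v j) = z.
  exact: esym (segment_point_eq e1 e2).
have zi : on_edge (e i) z by rewrite on_edge_e; exists s.
have zj : on_edge (e j) z by rewrite on_edge_e -zE; exists t.
have [si0 si1] := on_segment_scale (v_neq i) (erefl z).
have [sj0 sj1] := on_segment_scale (v_neq j) zE.
have [im jm] : (i < m)%N /\ (j < m)%N by lia.
have im1 : (i.+1 < m)%N by lia.
have [[zi0|zi1] [zj0|zj1]] := meet_vertex ij zi zj.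
- by have := mod_lt im jm (etrans (esym zi0) zj0); lia.
- right; have := etrans (esym zi0) zj1; rewrite -[v j.+1]v_mod => h.
  have [jm1|jm1] := eqVneq j.+1 m.
    split; [|lia|exact: si0|exact: sj1].
    by move: h; rewrite jm1 modnn => /(mod_lt im m_gt0).
  have jm2 : (j.+1 < m)%N by lia.
  by move: h; rewrite modn_small // => /(mod_lt im jm2); lia.
- by left; split; [have := mod_lt im1 jm (etrans (esym zi1) zj0); lia|exact: si1|exact: sj0].
- exfalso; have := etrans (esym zi1) zj1; rewrite -[v j.+1]v_mod => h.
  have [jm1|jm1] := eqVneq j.+1 m.
    by move: h; rewrite jm1 modnn => /(mod_lt im1 m_gt0).
  have jm2 : (j.+1 < m)%N by lia.
  by move: h; rewrite modn_small // => /(mod_lt im1 jm2); lia.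
Qed.

Let l_neq0 : l != 0. Proof. by have [] := hl. Qed.

Let cross_dir f : f \in c -> cross (edge_dir f) l != 0.
Proof. by move=> /c_internal; have [_ _ + _] := hl; apply. Qed.

Let eE i : (i < m)%N -> nth e0 c i = e i.
Proof. by move=> im; rewrite /e modn_small. Qed.

Let cycle_turns_odd : (forall g, g \in c -> pos (tail g) = v 0%N \/
    right_half l (pos (tail g) - v 0%N)) ->
  odd (\sum_(f <- c) `|turn_wind l (edge_dir f) (edge_dir (next c f))|).
Proof.
move=> min0; rewrite odd_sum (big_nth e0) big_mkord.
have [N mN] : exists N, m = N.+3 by exists (m - 3)%N; lia.
have -> : \big[addb/false]_(i < m) odd `|turn_wind l (edge_dir (nth e0 c i))
      (edge_dir (next c (nth e0 c i)))| =
    \big[addb/false]_(i < m) sweeps l (v i.+1 - v i) (v i.+2 - v i.+1).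
  apply: eq_bigr => i _; rewrite eE // next_e turn_wind_sweeps ?cross_dir //.
  by rewrite !dir_e.
have vm1 : v m.+1 = v 1%N by rewrite -v_mod -[v 1%N]v_mod -addn1 modnDl.
have ext j : (0 < j < m)%N -> right_half l (v j - v 0%N).
  move=> jm; case: (min0 _ (e_mem j)) => // h.
  by have := @mod_lt j 0%N; rewrite {1}/v h => /(_ _ _ erefl); lia.
by rewrite mN; apply: polygon_sweeps_odd => //; rewrite -?mN.
Qed.

(** Counting by source instead of by edge reduces this to one closed polygon and one ray at a
    time. *)
Let cycle_int_even : ~~ odd (\sum_(f <- c) edge_int l f).
Proof.
rewrite odd_sum.
have E f : f \in c -> odd (edge_int l f) = \big[addb/false]_(b in sources G)
    sweeps l (pos (tail f) - pos (inl b : vertex)) (pos (Defs.head f) - pos (inl b : vertex)).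
  move=> fc; rewrite /edge_int -sum1_card odd_sum big_mkcond [RHS]big_mkcond /=.
  apply: eq_bigr => b _; rewrite inE; case: (b \in sources G) => //=.
  have fi := c_internal fc; have [_ _ _ noray] := hl.
  have nor (u : vertex) : ~~ is_boundary u -> forall t, 0 <= t -> pos u <> pos (inl b : vertex) + t *: l.
    by case: u => // u _ t t0 h; apply: (noray b u); exists t.
  have [tf hf] := andP fi.
  have := @ray_hit_sweeps _ l (pos (inl b : vertex)) (pos (tail f)) (pos (Defs.head f))
    (cross_dir fc) (nor _ tf) (nor _ hf) (fun z => @internal_not_boundary_point f b z fi).
  by case=> h1 h2; case: asboolP => [/h1->//|h]; case: sweeps h2 => // /(_ isT) /h.
rewrite big_seq (eq_bigr _ E) -big_seq exchange_big big1 // => b _.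
rewrite (big_nth e0) big_mkord.
rewrite -[RHS](@polygon_ray_parity _ _ l_neq0 (in_disk G) (pos (inl b : vertex)) m v) //.
- by apply: eq_bigr => i _; rewrite eE // head_e.
- exact: boundary_vertex_on_boundary.
- move=> i im z; rewrite -on_edge_e => ze; split; first exact: (edges_in_disk hG ze).
  by apply: internal_not_boundary_point ze; exact: c_internal.
Qed.

Lemma cycle_odd_from : (forall g, g \in c -> pos (tail g) = pos (tail (nth e0 c 0)) \/
    right_half l (pos (tail g) - pos (tail (nth e0 c 0)))) ->
  odd (\sum_(f <- c) (`|turn_wind l (edge_dir f) (edge_dir (next c f))| + edge_int l f)).
Proof.
rewrite (eE m_gt0) => h.
by rewrite big_split oddD cycle_turns_odd // (negPf cycle_int_even).
Qed.

End OneCycle.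

Lemma cycle_odd (l : R * R) (c : seq edge) : gauge_direction G l ->
  c != [::] -> uniq c -> path.cycle (@follows R n G) c ->
  odd (\sum_(f <- c) (`|turn_wind l (edge_dir f) (edge_dir (next c f))| + edge_int l f)).
Proof.
move=> hl c0 cu cc; have l0 : l != 0 by have [] := hl.
(* The Umlaufsatz needs an extremal base vertex; rotating the cycle to start there changes neither
   the sum nor [next]. *)
have [f fc fmin] := lex_min (fun f : edge => pos (tail f)) l0 c0.
have [i c' rc] := rot_to fc.
have c'u : uniq (rot i c) by rewrite rot_uniq.
have c'c : path.cycle (@follows R n G) (rot i c) by rewrite rot_cycle.
have c'0 : rot i c != [::] by rewrite rc.
rewrite -(perm_big _ (introT permPl (perm_rot i c))) /=.
have := cycle_odd_from (e0 := f) hl c'0 c'u c'c.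
under [in X in _ -> X]eq_bigr do rewrite -(next_rot i) //.
by apply=> g; rewrite mem_rot {1 2}rc; exact: fmin.
Qed.


End Cycles.

(** * Signed walks and their transfer matrix *)

Lemma prod_porbits (T : finType) (S : comNzRingType) (s : {perm T}) (a : T -> S) :
  \prod_(O in porbits s) \prod_(f in O) a f = \prod_f a f.
Proof.
rewrite [RHS](partition_big (porbit s) (mem (porbits s))) /=; last first.
  by move=> f _; exact: imset_f.
apply: eq_bigr => O /imsetP[g _ ->]; apply: eq_bigl => f.
by rewrite eq_porbit_mem.
Qed.

(** The sign of a permutation has the parity of the number of points plus the number of orbits,
    hence one minus sign for each point and one for each orbit. *)
Lemma perm_sign_prod (T : finType) (S : comNzRingType) (s : {perm T}) (a : T -> S) :
  (-1) ^+ s * \prod_f a f = \prod_(O in porbits s) - \prod_(f in O) - a f.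
Proof.
rewrite [RHS]prodrN prod_porbits prodrN mulrA -exprD; congr (_ * _).
by rewrite -signr_odd -[RHS]signr_odd /odd_perm oddb oddD addbC.
Qed.

Lemma traject_porbit_fcycle (T : finType) (s : {perm T}) (f : T) :
  fcycle s (traject s f #|porbit s f|).
Proof.
have := iter_porbit s f; case E: #|_| => [|n]; first by [].
move=> itf; rewrite /= -[X in rcons _ X]itf iterSr -trajectSr; exact: fpath_traject.
Qed.

Lemma prod_porbit (T : finType) (S : comNzRingType) (s : {perm T}) (f : T) (a : T -> S) :
  \prod_(g in porbit s f) a g = \prod_(g <- traject s f #|porbit s f|) a g.
Proof.
rewrite (eq_bigl _ _ (porbit_traject s f)).
by rewrite [RHS]big_uniq ?uniq_traject_porbit.
Qed.

Section Transfer.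
Variables (R : realType) (n : nat) (G : drawing R n) (l : R * R).
Variables (S : comNzRingType) (x : 'I_(ne G) -> S).
Local Notation edge := 'I_(ne G).

Lemma odd_absz_add (a b : int) : odd `|a + b| = odd `|a| (+) odd `|b|.
Proof. by rewrite -oddD; lia. Qed.

(** The intersections of [f] are charged to the step leaving [f]; those of the final edge are left
    to [last_step]. *)
Definition turn_sign (f g : edge) : S :=
  (-1) ^+ (`|turn_wind l (edge_dir f) (edge_dir g)| + edge_int l f).

Lemma path_sign1 (f : edge) : path_sign l S [:: f] = (-1) ^+ edge_int l f.
Proof.
by rewrite /path_sign /path_wind /path_int /= big_nil big_seq1 add0r absz_nat.
Qed.

Lemma path_sign_cons (f g : edge) (P : seq edge) :
  path_sign l S (f :: g :: P) = turn_sign f g * path_sign l S (g :: P).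
Proof.
rewrite /path_sign /path_wind /path_int /turn_sign /= !big_cons /= -signr_odd.
rewrite -[in RHS]signr_odd -[X in _ = _ * X]signr_odd -signr_addb; congr (_ ^+ _).
congr nat_of_bool; rewrite !PoszD !(odd_absz_add, oddD) /=.
by rewrite -!addbA; congr (_ (+) _); rewrite !addbA [X in X (+) _ (+) _]addbC.
Qed.

Definition transfer : 'M[S]_(ne G) :=
  \matrix_(f, g) if follows f g then x f * turn_sign f g else 0.

Definition last_step (j : 'I_n) : 'cV[S]_(ne G) :=
  \col_f if Defs.head f == inl j then x f * (-1) ^+ edge_int l f else 0.

Definition path_sum (e : edge) (j : 'I_n) (m : nat) : S :=
  \sum_(P : m.-tuple edge | path_to e j P) path_sign l S P * \prod_(f <- P) x f.

Definition walk_vec (j : 'I_n) (m : nat) : 'cV[S]_(ne G) :=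
  iter m (mulmx transfer) (last_step j).

Lemma big_tuple_cons (T : finType) (m : nat) (F : seq T -> S) :
  \sum_(P : m.+1.-tuple T) F P = \sum_a \sum_(P : m.-tuple T) F (a :: P).
Proof.
rewrite pair_big (reindex (fun p : T * m.-tuple T => [tuple of p.1 :: p.2])) //=.
exists (fun P => (thead P, [tuple of behead P])) => [[a P] _|P _] /=.
  by congr (_, _); apply: val_inj.
by rewrite [RHS]tuple_eta; apply: val_inj.
Qed.

Lemma path_sum0 e j : path_sum e j 0 = 0.
Proof. by rewrite /path_sum big1 // => P; rewrite tuple0. Qed.

Lemma path_sumS e j m : path_sum e j m.+1 = walk_vec j m e ord0.
Proof.
rewrite /path_sum big_mkcond.
rewrite (big_tuple_cons _ (fun P => if path_to e j P then path_sign l S P * \prod_(f <- P) x f else 0)).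
rewrite (bigD1 e) //= [X in _ + X]big1 ?addr0; last first.
  by move=> f fe; rewrite big1 // => P _; rewrite /= (negPf fe).
elim: m e => [|m IH] e.
  rewrite (big_pred1 [tuple]) => [|P]; last by rewrite (tuple0 P) /= eqxx.
  rewrite /= eqxx /= /last_step mxE path_sign1 big_seq1.
  by case: ifP => // _; rewrite mulrC.
rewrite (big_tuple_cons _ (fun P => if path_to e j (e :: P) then path_sign l S (e :: P) * \prod_(f <- e :: P) x f else 0)).
rewrite /walk_vec iterS -/(walk_vec j m) mxE; apply: eq_bigr => g _.
rewrite -IH big_distrr /=; apply: eq_bigr => P _.
rewrite !eqxx /= mxE; case: (follows e g); rewrite /= ?mul0r //.
case: ifP => _; rewrite ?mulr0 // path_sign_cons !big_cons.
by rewrite mulrACA; congr (_ * _); rewrite mulrC.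
Qed.

Lemma transfer_telescope j N :
  (1%:M - transfer) *m (\sum_(m < N) walk_vec j m) = last_step j - walk_vec j N.
Proof.
elim: N => [|N IH]; first by rewrite big_ord0 mulmx0 subrr.
rewrite big_ord_recr /= mulmxDr IH mulmxBl mul1mx -[transfer *m _]/(walk_vec j N.+1).
by rewrite addrA subrK.
Qed.

(** The adjugate is used instead of an inverse, so no invertibility is required of the ring
    elements; the second term is the remainder after [N] steps. *)
Lemma det_path_sum e j N :
  \det (1%:M - transfer) * \sum_(m < N.+1) path_sum e j m =
  (\adj (1%:M - transfer) *m last_step j) e ord0 -
  (\adj (1%:M - transfer) *m walk_vec j N) e ord0.
Proof.
have := congr1 (fun v => (\adj (1%:M - transfer) *m v) e ord0) (transfer_telescope j N).
rewrite mulmxA mul_adj_mx mul_scalar_mx mulmxBr !mxE => <-.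
rewrite big_ord_recl path_sum0 add0r summxE; congr (_ * _).
by apply: eq_bigr => m _; rewrite path_sumS.
Qed.

End Transfer.

(** * Flows as permutations of the edges *)

Section FlowPerms.
Variables (R : realType) (n k : nat) (G : drawing R n).
Hypothesis hG : plabic G k.
Local Notation edge := 'I_(ne G).
Local Notation vertex := ('I_n + 'I_(nv G))%type.
(* [b] selects between the two kinds of flows: conservative ones if it is [false],
   and flows entering through [e] and leaving through [e'] if it is [true]; in the
   latter case the flow is closed up by sending [e'] to [e]. *)
Variables (b : bool) (e e' : edge).

Definition flow_perm (s : {perm edge}) : bool :=
  (b ==> (s e' == e)) &&
  [forall f, (b && (f == e')) || (s f == f) || follows f (s f)].

(** If [e = e'], the closed-up permutation fixes [e'], which must nevertheless belong to the
    flow. *)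
Definition flow_support (s : {perm edge}) : {set edge} :=
  [set f | (b && (f == e')) || (s f != f)].

(** The closing step from [e'] to [e] passes through no vertex, so the head of [e'] and the tail of
    [e] are left out of the counts. *)
Definition flow_in (F : {set edge}) (v : vertex) : {set edge} :=
  [set f in F | ~~ (b && (f == e')) && (Defs.head f == v)].

Definition flow_out (F : {set edge}) (v : vertex) : {set edge} :=
  [set f in F | ~~ (b && (f == e)) && (tail f == v)].

Definition balanced (F : {set edge}) : bool :=
  (b ==> (e \in F) && (e' \in F)) &&
  [forall v, (#|flow_in F v| == #|flow_out F v|) && (#|flow_in F v| <= 1)%N].

Lemma flow_perm_special (s : {perm edge}) : flow_perm s -> b -> s e' = e.
Proof. by case/andP => /implyP h _ /h/eqP. Qed.

Lemma flow_perm_follows (s : {perm edge}) f : flow_perm s -> f \in flow_support s ->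
  ~~ (b && (f == e')) -> follows f (s f).
Proof.
case/andP => _ /forallP/(_ f); rewrite inE => /orP[/orP[->//|/eqP->]|//].
by rewrite eqxx orbF => ->.
Qed.

Lemma flow_support_stable (s : {perm edge}) f : (s f \in flow_support s) = (f \in flow_support s).
Proof.
rewrite !inE (inj_eq perm_inj); have [->|] := eqVneq (s f) f; first by [].
by rewrite !orbT.
Qed.

Lemma flow_le1 (F : {set edge}) v :
  #|flow_in F v| = #|flow_out F v| -> (#|flow_in F v| <= 1)%N.
Proof.
have i_le : (#|flow_in F v| <= #|in_edges v|)%N.
  by apply: subset_leq_card; apply/fintype.subsetP => f; rewrite !inE => /andP[_ /andP[]].
have o_le : (#|flow_out F v| <= #|out_edges v|)%N.
  by apply: subset_leq_card; apply/fintype.subsetP => f; rewrite !inE => /andP[_ /andP[]].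
move=> E; case: v i_le o_le E => [a|v] i_le o_le E.
  by have := boundary_deg1 hG a; rewrite /indeg /outdeg; lia.
by case: (internal_in_out hG v); lia.
Qed.

Lemma flow_support_balanced (s : {perm edge}) : flow_perm s -> balanced (flow_support s).
Proof.
move=> hs; apply/andP; split.
  apply/implyP => bt; rewrite !inE bt eqxx /= andbT.
  have [//|ne] := eqVneq e e'; rewrite /=.
  by apply: contra_neq ne => se; apply: (@perm_inj _ s); rewrite se (flow_perm_special hs).
apply/forallP => v; suff E : flow_out (flow_support s) v = s @: flow_in (flow_support s) v.
  have E' : #|flow_in (flow_support s) v| = #|flow_out (flow_support s) v|.
    by rewrite E card_imset //; exact: perm_inj.
  by rewrite flow_le1 // E' eqxx.
apply/setP => g; apply/idP/imsetP => [|[f]]; rewrite inE.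
  case/andP=> gS /andP[gsp /eqP tg]; exists (s^-1%g g); last by rewrite permKV.
  have fS : (s^-1%g g) \in flow_support s by rewrite -flow_support_stable permKV.
  have fsp : ~~ (b && (s^-1%g g == e')).
    apply: contra gsp => /andP[bt /eqP h]; rewrite bt -(flow_perm_special hs bt) -h permKV.
    by rewrite eqxx.
  by rewrite inE fS fsp /= (eqP (flow_perm_follows hs fS fsp)) permKV tg.
case/andP=> fS /andP[fsp /eqP hf] ->.
rewrite inE flow_support_stable fS /= -(eqP (flow_perm_follows hs fS fsp)) hf eqxx andbT.
apply: contra fsp => /andP[bt /eqP h]; rewrite bt -(inj_eq (@perm_inj _ s)) h.
by rewrite (flow_perm_special hs bt) eqxx.
Qed.

Lemma flow_perm_inj (s t : {perm edge}) : flow_perm s -> flow_perm t ->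
  flow_support s = flow_support t -> s = t.
Proof.
move=> hs ht st; have /andP[_ /forallP bal] := flow_support_balanced hs.
have out (u : {perm edge}) f : flow_perm u -> f \in flow_support u -> ~~ (b && (f == e')) ->
    u f \in flow_out (flow_support u) (Defs.head f).
  move=> hu fu fsp; rewrite inE flow_support_stable fu /= -(eqP (flow_perm_follows hu fu fsp)).
  rewrite eqxx andbT; apply: contra fsp => /andP[bt /eqP h].
  by rewrite bt -(inj_eq (@perm_inj _ u)) h (flow_perm_special hu bt) eqxx.
apply/permP => f; have [fsp|fsp] := boolP (b && (f == e')).
  by case/andP: fsp => bt /eqP->; rewrite !flow_perm_special.
have [fS|fS] := boolP (f \in flow_support s); last first.
  have := fS; rewrite inE negb_or fsp negbK /= => /eqP->.
  by move: fS; rewrite st inE negb_or fsp negbK /= => /eqP->.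
have /andP[/eqP c1 c2] := bal (Defs.head f); rewrite c1 in c2.
by apply: (card_le1_eqP c2); [rewrite st; apply: out; rewrite -?st | exact: out].
Qed.

Lemma balanced_flow_perm F : balanced F ->
  exists2 s : {perm edge}, flow_perm s & flow_support s = F.
Proof.
case/andP=> /implyP eF /forallP bal.
(* On [F] the default [f] is never reached: balance provides an outgoing edge. The bound by 1 on
   incoming edges will give injectivity. *)
pose succ f := if b && (f == e') then e
  else if f \in F then odflt f [pick g in flow_out F (Defs.head f)] else f.
have succF f : f \in F -> ~~ (b && (f == e')) -> succ f \in flow_out F (Defs.head f).
  move=> fF fsp; rewrite /succ (negPf fsp) fF; case: pickP => [//|none].
  have /andP[/eqP c1 _] := bal (Defs.head f).
  suff : (0 < #|flow_out F (Defs.head f)|)%N by rewrite (eq_card0 none).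
  by rewrite -c1; apply/card_gt0P; exists f; rewrite inE fF fsp /=.
have succ_sp f : b && (f == e') -> succ f = e by rewrite /succ => ->.
have succ_out f : ~~ (b && (f == e')) -> f \notin F -> succ f = f.
  by rewrite /succ => /negPf-> /negPf->.
have succ_inF f : f \in F -> succ f \in F.
  move=> fF; have [fsp|/(succF f fF)] := boolP (b && (f == e')).
    by rewrite succ_sp //; case/andP: fsp => /eF/andP[].
  by rewrite inE => /andP[].
have spF f : b && (f == e') -> f \in F by case/andP => /eF/andP[_ h] /eqP->.
have succ_neq_e f : f \in F -> ~~ (b && (f == e')) -> ~~ (b && (succ f == e)).
  by move=> fF fsp; have := succF f fF fsp; rewrite inE => /andP[_ /andP[]].
have succ_inj : injective succ.
  move=> f g E.
  have [fF|fF] := boolP (f \in F); have [gF|gF] := boolP (g \in F); first last.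
  - by move: E; rewrite !succ_out //; apply: contraNN (@spF _) _.
  - have gE : succ f = f by apply: succ_out => //; apply: contra fF; exact: spF.
    by have := succ_inF g gF; rewrite -E gE (negPf fF).
  - have gE : succ g = g by apply: succ_out => //; apply: contra gF; exact: spF.
    by have := succ_inF f fF; rewrite E gE (negPf gF).
  have [fsp|fsp] := boolP (b && (f == e')); have [gsp|gsp] := boolP (b && (g == e')).
  - by case/andP: fsp => _ /eqP->; case/andP: gsp => _ /eqP->.
  - have := succ_neq_e g gF gsp; rewrite -E (succ_sp f fsp) eqxx andbT.
    by case/andP: fsp => ->.
  - have := succ_neq_e f fF fsp; rewrite E (succ_sp g gsp) eqxx andbT.
    by case/andP: gsp => ->.
  have := succF f fF fsp; have := succF g gF gsp.
  rewrite -E !inE => /andP[_ /andP[_ /eqP hg]] /andP[_ /andP[_ /eqP hf]].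
  have /andP[_ c] := bal (Defs.head f).
  by apply: (card_le1_eqP c); rewrite inE ?fF ?gF ?fsp ?gsp -?hf -?hg eqxx.
have follow f : f \in F -> ~~ (b && (f == e')) -> follows f (succ f).
  move=> fF fsp; have := succF f fF fsp.
  by rewrite inE => /andP[_ /andP[_ /eqP h]]; rewrite /follows h.
exists (perm succ_inj).
  apply/andP; split.
    by apply/implyP => bt; rewrite permE succ_sp // bt eqxx.
  apply/forallP => f; rewrite permE; have [//|fsp] := boolP (b && _).
  have [fF|fF] := boolP (f \in F); first by rewrite follow ?orbT.
  by rewrite succ_out ?eqxx.
apply/setP => f; rewrite inE permE; have [/spF->//|fsp] := boolP (b && _).
have [fF|fF] := boolP (f \in F); last by rewrite succ_out ?eqxx.
by apply: contraTneq (follow f fF fsp) => ->; rewrite (follows_irrefl hG).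
Qed.

End FlowPerms.

Section FlowSums.
Variables (R : realType) (n k : nat) (G : drawing R n).
Hypothesis hG : plabic G k.
Local Notation edge := 'I_(ne G).
Local Notation vertex := ('I_n + 'I_(nv G))%type.

Lemma big_balanced (S : nmodType) (b : bool) (e e' : edge) (H : {set edge} -> S) :
  \sum_(F | balanced b e e' F) H F =
  \sum_(s | flow_perm b e e' s) H (flow_support b e' s).
Proof.
rewrite [RHS](partition_big (flow_support b e') (balanced b e e')) /=; last first.
  by move=> s; exact: (flow_support_balanced hG).
apply: eq_bigr => F /(balanced_flow_perm hG)[s hs <-].
rewrite (big_pred1 s) // => t; apply/andP/eqP => [[ht /eqP E]|->//].
exact: (flow_perm_inj hG ht hs E).
Qed.

Lemma sink_edge (j : 'I_n) : j \notin sources G ->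
  exists2 e' : edge, Defs.head e' = inl j & forall f : edge, Defs.head f = inl j -> f = e'.
Proof.
have := boundary_deg1 hG j; rewrite inE => d jo.
have i1 : indeg (inl j : vertex) = 1%N by lia.
have /cards1P[e' E] : #|in_edges (inl j : vertex)| == 1%N by exact/eqP.
have in' f : (f == e') = (Defs.head f == inl j).
  by move/setP/(_ f): E; rewrite !inE.
by exists e' => [|f hf]; apply/eqP; rewrite ?in' ?hf // -in'.
Qed.

(** At a boundary vertex, which has a single edge, balance means that [C] avoids it; this recovers
    the internality of all edges of [C]. *)
Lemma conservative_balanced (e e' : edge) C : conservative C = balanced false e e' C.
Proof.
have inE' v : flow_in false e' C v = C :&: in_edges v by apply/setP => f; rewrite !inE.
have outE v : flow_out false e C v = C :&: out_edges v by apply/setP => f; rewrite !inE.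
apply/andP/andP => -[].
  move=> /forall_inP int /forallP bal; split=> //; apply/forallP => v.
  suff E : #|flow_in false e' C v| = #|flow_out false e C v|.
    by rewrite (flow_le1 hG E) E eqxx.
  rewrite inE' outE; case: v => [a|v]; last exact/eqP.
  by rewrite !eq_card0 // => f; rewrite !inE; apply/negP => /andP[/int /andP[]];
    [move=> + _ /eqP h | move=> _ + /eqP h]; rewrite h.
move=> _ /forallP bal; split; last first.
  by apply/forallP => v; have /andP[] := bal (inr v); rewrite inE' outE.
have bd a f g : f \in C -> g \in C -> Defs.head f = inl a -> tail g = inl a -> False.
  by move=> _ _; exact: (boundary_in_out hG).
apply/forall_inP => f fC; rewrite /internal_edge; apply/andP; split; apply/negP.
  case tf: (tail f) => [a|//] _; have /andP[/eqP E _] := bal (inl a).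
  have /card_gt0P[g] : (0 < #|flow_in false e' C (inl a)|)%N.
    by rewrite E; apply/card_gt0P; exists f; rewrite inE fC tf /=.
  by rewrite inE => /andP[gC /eqP hg]; exact: (bd a g f).
case hf: (Defs.head f) => [a|//] _; have /andP[/eqP E _] := bal (inl a).
have /card_gt0P[g] : (0 < #|flow_out false e C (inl a)|)%N.
  by rewrite -E; apply/card_gt0P; exists f; rewrite inE fC hf /=.
by rewrite inE => /andP[gC /eqP tg]; exact: (bd a f g).
Qed.

(** The definition of an edge flow imposes no condition at the sinks. Summing over all vertices
    shows that the one unit emitted at [tail e] is absorbed by exactly one boundary vertex, which
    must be [j]. *)
Lemma edge_flow_to_balanced (e e' : edge) (j : 'I_n) F :
  Defs.head e' = inl j -> (forall f : edge, Defs.head f = inl j -> f = e') ->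
  edge_flow_to e j F = balanced true e e' F.
Proof.
move=> he' e'_uniq.
have inE' v : flow_in true e' F v = (F :&: in_edges v) :\ e'.
  by apply/setP => f; rewrite !inE /= andbCA.
have outE v : flow_out true e F v = (F :&: out_edges v) :\ e.
  by apply/setP => f; rewrite !inE /= andbCA.
have cardin v : e' \in F -> #|F :&: in_edges v| = ((v == inl j) + #|flow_in true e' F v|)%N.
  by move=> eF; rewrite inE' (cardsD1 e') !inE eF he' eq_sym.
have cardout v : e \in F -> #|F :&: out_edges v| = ((v == tail e) + #|flow_out true e F v|)%N.
  by move=> eF; rewrite outE (cardsD1 e) !inE eF eq_sym.
apply/idP/idP.
  case/andP=> /and4P[eF /forallP bal /eqP bale /forall_inP bsrc] /exists_inP[f fF /eqP /e'_uniq fe'].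
  rewrite {f}fe' in fF.
  rewrite /balanced /= eF fF; apply/forallP => v.
  have out_bd a : #|F :&: out_edges (inl a)| = (inl a == tail e).
    apply/eqP; rewrite (cardout _ eF) -{2}[nat_of_bool _]addn0 eqn_add2l.
    apply/eqP/eq_card0 => f; rewrite !inE /=; apply/negP => /andP[fC /andP[fe /eqP tf]].
    by have := bsrc f fC; rewrite tf (negPf fe).
  have int_bal v' : (#|F :&: in_edges (inr v')| + (inr v' == tail e) = #|F :&: out_edges (inr v')|)%N.
    have [E|ne] := eqVneq (inr v') (tail e); first by rewrite E addn1.
    by rewrite addn0; apply/eqP; move/implyP: (bal v'); apply.
  have tot (h : edge -> vertex) : (\sum_v #|[set f in F | h f == v]| = #|F|)%N.
    rewrite -sum1_card (partition_big h xpredT) //=.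
    by apply: eq_bigr => u _; rewrite -sum1_card; apply: eq_bigl => f; rewrite !inE.
  have tin : (\sum_v #|F :&: in_edges v| = #|F|)%N.
    rewrite -(tot (@Defs.head R n G)); apply: eq_bigr => u _.
    by apply: eq_card => f; rewrite !inE.
  have tout : (\sum_v #|F :&: out_edges v| = #|F|)%N.
    rewrite -(tot (@tail R n G)); apply: eq_bigr => u _.
    by apply: eq_card => f; rewrite !inE.
  have one : (\sum_v (v == tail e) = 1)%N.
    by rewrite -big_mkcond /= sum1_card; apply: eq_card1.
  have sinks : (\sum_a #|F :&: in_edges (inl a)| = 1)%N.
    rewrite big_sumType /= in tin; rewrite big_sumType /= in tout.
    rewrite big_sumType /= in one.
    have o1 : (\sum_a #|F :&: out_edges (inl a)| = \sum_(a : 'I_n) (inl a == tail e))%N.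
      by apply: eq_bigr => a _; rewrite out_bd.
    have o2 : (\sum_v' #|F :&: out_edges (inr v')| =
      \sum_v' #|F :&: in_edges (inr v')| + \sum_(v' : 'I_(nv G)) (inr v' == tail e))%N.
      by rewrite -big_split; apply: eq_bigr => v' _; rewrite -int_bal.
    by move: tout; rewrite o1 o2 addnCA one -tin addnC => /addIn.
  suff E : #|flow_in true e' F v| = #|flow_out true e F v|.
    by rewrite (flow_le1 hG E) E eqxx.
  have hin := cardin v fF; have hout := cardout v eF.
  case: v hin hout => [a|v] hin hout; last first.
    by apply/eqP; rewrite -(eqn_add2l (inr v == tail e)) -hout -int_bal addnC hin.
  rewrite out_bd in hout.
  have -> : #|flow_out true e F (inl a)| = 0%N.
    by apply/eqP; rewrite -(eqn_add2l (inl a == tail e)) -hout addn0.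
  have hj := cardin (inl j) fF; rewrite eqxx add1n in hj.
  move: sinks; rewrite (bigD1 j) //= hj addSn => -[] /eqP; rewrite addn_eq0 => /andP[/eqP hj0].
  have [->//|aj] := eqVneq a j.
  rewrite (bigD1 a) //= addn_eq0 => /andP[+ _].
  by rewrite hin addn_eq0 => /andP[_ /eqP].
case/andP=> /= /andP[eF e'F] /forallP bal.
have noin a : #|flow_in true e' F (inl a)| = 0%N.
  have /andP[/eqP E _] := bal (inl a).
  apply/eqP; rewrite -leqn0 leqNgt; apply/negP => h.
  have := h; rewrite E => /card_gt0P[g]; rewrite inE => /andP[_ /andP[_ /eqP tg]].
  have /card_gt0P[f] := h; rewrite inE => /andP[_ /andP[_ /eqP hf]].
  exact: (boundary_in_out hG hf tg).
have tej : (tail e == inl j) = false.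
  by apply/eqP => te; exact: (boundary_in_out hG he' te).
apply/andP; split; last by apply/exists_inP; exists e'; rewrite ?he'.
apply/and4P; split=> //.
- apply/forallP => v; apply/implyP => ne; have /andP[/eqP E _] := bal (inr v).
  by rewrite (cardin _ e'F) (cardout _ eF) E (negPf ne).
- by have /andP[/eqP E _] := bal (tail e); rewrite (cardin _ e'F) (cardout _ eF) E eqxx tej.
apply/forall_inP => f fF; apply/implyP; case tf: (tail f) => [a|//] _.
have /andP[/eqP E _] := bal (inl a).
apply/negPn/negP => fe; have : (0 < #|flow_out true e F (inl a)|)%N.
  by apply/card_gt0P; exists f; rewrite inE fF fe tf /=.
by rewrite -E noin.
Qed.

End FlowSums.

Lemma porbit_fixed (T : finType) (s : {perm T}) (f g : T) :
  g \in porbit s f -> (s g == g) = (s f == f).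
Proof.
case/porbitP => i ->; rewrite -permM -expgSr expgS permM.
by rewrite (inj_eq perm_inj).
Qed.

(** * Expansion of the determinant and of the cofactor over flows *)

Section CycleExpansion.
Variables (R : realType) (n k : nat) (G : drawing R n).
Hypothesis hG : plabic G k.
Variables (l : R * R) (hl : gauge_direction G l).
Local Notation edge := 'I_(ne G).
Variables (S : comNzRingType) (x : edge -> S).
Local Notation T := (transfer l x).

Lemma transfer_diag f g : f != g -> (1%:M - T) f g = - T f g.
Proof. by move=> fg; rewrite !mxE (negPf fg) sub0r. Qed.

Lemma transfer_fixed f : (1%:M - T) f f = 1.
Proof. by rewrite !mxE (follows_irrefl hG) eqxx subr0. Qed.

Lemma cycle_turn_sign (c : seq edge) : c != [::] -> uniq c ->
  path.cycle (@follows R n G) c -> \prod_(f <- c) turn_sign l S f (next c f) = -1.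
Proof.
move=> c0 cu cc; rewrite /turn_sign.
rewrite -(big_morph (fun m => (-1) ^+ m) (exprD (-1)) (expr0 _)).
by rewrite -signr_odd (cycle_odd hG hl c0 cu cc) expr1.
Qed.

Variables (b : bool) (e e' : edge).

(* Each nontrivial cycle of a flow permutation contributes the product of its edge
   variables with sign +1: it has one minus sign as an orbit and one as a closed
   walk. *)
Lemma porbit_contribution (s : {perm edge}) f : flow_perm b e e' s ->
  (b -> e' \notin porbit s f) ->
  - (\prod_(g in porbit s f) - (1%:M - T) g (s g)) =
  \prod_(g in porbit s f) if g \in flow_support b e' s then x g else 1.
Proof.
move=> hs no_e'.
have nsp g : g \in porbit s f -> ~~ (b && (g == e')).
  by move=> gO; apply/negP => /andP[bt /eqP ge]; move: (no_e' bt); rewrite -ge gO.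
have insupp g : g \in porbit s f -> (g \in flow_support b e' s) = (s f != f).
  by move=> gO; rewrite inE (negPf (nsp g gO)) (porbit_fixed gO).
have [sf|sf] := eqVneq (s f) f.
  have O1 : porbit s f =i pred1 f.
    move=> g; rewrite inE; apply/idP/eqP => [/porbitP[i ->]|->]; last exact: porbit_id.
    by elim: i => [|i IH]; rewrite ?perm1 // expgSr permM IH.
  rewrite !(eq_bigl _ _ O1) !big_pred1_eq insupp ?porbit_id // sf eqxx /=.
  by rewrite transfer_fixed opprK.
have O_follows g : g \in porbit s f -> follows g (s g).
  by move=> gO; apply: (flow_perm_follows hs) (nsp g gO); rewrite insupp.
rewrite (eq_bigr (fun g => x g * turn_sign l S g (s g))); last first.
  move=> g gO; rewrite transfer_diag; last by rewrite eq_sym (porbit_fixed gO).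
  by rewrite opprK mxE O_follows.
rewrite big_split /= [X in _ * X]prod_porbit.
pose c := traject s f #|porbit s f|.
have fc : fcycle s c by exact: traject_porbit_fcycle.
have cO g : (g \in c) = (g \in porbit s f) by rewrite porbit_traject.
have c0 : c != [::] by apply: contraTneq (porbit_id s f) => E; rewrite -cO E.
have -> : \prod_(g <- c) turn_sign l S g (s g) = \prod_(g <- c) turn_sign l S g (next c g).
  by rewrite big_seq [RHS]big_seq; apply: eq_bigr => g gc; rewrite (nextE fc).
rewrite cycle_turn_sign ?uniq_traject_porbit // ?mulrN1 ?opprK.
  by apply: eq_bigr => g gO; rewrite insupp ?sf.
apply: cycle_from_next; first exact: uniq_traject_porbit.
by move=> g gc; rewrite (nextE fc) //; apply: O_follows; rewrite -cO.
Qed.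

End CycleExpansion.

Section Expansion.
Variables (R : realType) (n k : nat) (G : drawing R n).
Hypothesis hG : plabic G k.
Variables (l : R * R) (hl : gauge_direction G l).
Local Notation edge := 'I_(ne G).
Variables (S : comNzRingType) (x : edge -> S).
Local Notation T := (transfer l x).

Lemma prod_flow_support (b : bool) (e' : edge) (s : {perm edge}) :
  \prod_f (if f \in flow_support b e' s then x f else 1) =
  \prod_(f in flow_support b e' s) x f.
Proof. by rewrite [RHS]big_mkcond. Qed.

Lemma det_transfer (e : edge) : \det (1%:M - T) = conservative_gf x.
Proof.
rewrite /conservative_gf (eq_bigl _ _ (conservative_balanced hG e e)).
rewrite (big_balanced hG) [RHS]big_mkcond; apply: eq_bigr => s _.
case: ifPn => hs.
  rewrite perm_sign_prod -prod_flow_support -(prod_porbits s).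
  by apply: eq_bigr => O /imsetP[f _ ->]; rewrite (porbit_contribution hG hl x hs).
move: hs; rewrite /flow_perm /= => /forallPn[f]; rewrite negb_or => /andP[sf ff].
by rewrite (bigD1 f) //= transfer_diag 1?eq_sym // mxE (negPf ff) oppr0 mul0r mulr0.
Qed.

Lemma path_sign_traject (s : {perm edge}) (e : edge) m :
  path_sign l S (traject s e m.+1) * \prod_(f <- traject s e m.+1) x f =
  (\prod_(f <- traject s e m) (x f * turn_sign l S f (s f))) *
  (x (iter m s e) * (-1) ^+ edge_int l (iter m s e)).
Proof.
elim: m e => [|m IH] e.
  by rewrite big_nil big_seq1 path_sign1 mul1r mulrC.
have := IH (s e); rewrite -iterSr => {}IH.
rewrite trajectS [traject _ (s e) _]trajectS path_sign_cons -trajectS big_cons.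
rewrite mulrACA IH [in RHS]trajectS big_cons mulrA.
by rewrite [turn_sign _ _ _ _ * _]mulrC !mulrA.
Qed.

Variables (j : 'I_n) (e e' : edge).
Hypotheses (he' : Defs.head e' = inl j)
  (e'_uniq : forall f : edge, Defs.head f = inl j -> f = e').

(** The orbit of [e], cut at the closing step from [e'] to [e], is the loop-erased walk; the other
    nontrivial orbits form the conservative flow. *)
Let walk (s : {perm edge}) := traject s e #|porbit s e|.

Section OnePerm.
Variables (s : {perm edge}) (hs : flow_perm true e e' s).
Local Notation F := (flow_support true e' s).

Let se' : s e' = e. Proof. exact: (flow_perm_special hs). Qed.

Let e'_orbit : porbit s e' = porbit s e.
Proof. by rewrite -se' -(porbit_perm s 1) expg1. Qed.

Let p := #|porbit s e|.-1.
Let pE : #|porbit s e| = p.+1.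
Proof. by rewrite prednK // lt0n card_porbit_neq0. Qed.

Let walk_rcons : walk s = rcons (traject s e p) e'.
Proof.
rewrite /walk pE trajectSr; congr (rcons _ _); apply: (@perm_inj _ s).
by rewrite se' -iterS -pE iter_porbit.
Qed.

Let last_walk : iter p s e = e'.
Proof. by have := walk_rcons; rewrite /walk pE trajectSr => /rcons_inj[]. Qed.

Let walk_uniq : uniq (walk s). Proof. exact: uniq_traject_porbit. Qed.

Let front_follows f : f \in traject s e p -> f != e' /\ follows f (s f).
Proof.
move=> fp; have fne : f != e'.
  by apply: contraTneq walk_uniq => fe; rewrite walk_rcons rcons_uniq -fe fp.
have fO : f \in porbit s e by rewrite porbit_traject -/(walk s) walk_rcons mem_rcons inE fp orbT.
split=> //; apply: (flow_perm_follows hs) => //; rewrite inE /= (negPf fne) /=.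
rewrite (porbit_fixed fO); apply: contra_neq fne => see.
have -> : f = e.
  by case/porbitP: fO => i ->; elim: i => [|i IH]; rewrite ?perm1 // expgSr permM IH.
by apply: (@perm_inj _ s); rewrite se'.
Qed.

Lemma walk_path_to : path_to e j (walk s).
Proof.
rewrite /walk pE /= eqxx /=.
have -> : last e (traject s (s e) p) = e'.
  by rewrite -[last _ _]/(last e (e :: traject s (s e) p)) -trajectS -pE -/(walk s) walk_rcons last_rcons.
rewrite he' eqxx andbT.
have : forall f, f \in traject s e p -> follows f (s f) by move=> f /front_follows[].
elim: p e => //= q IH f H; rewrite H ?mem_head //=.
by apply: IH => g gq; apply: H; rewrite inE gq orbT.
Qed.

Lemma walk_sub : {subset walk s <= F}.
Proof.
move=> f; rewrite walk_rcons mem_rcons inE => /orP[/eqP->|/front_follows[fe ff]].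
  by rewrite inE eqxx.
by rewrite inE; apply/orP; right; apply: contraTneq ff => ->; rewrite (follows_irrefl hG).
Qed.

Let mem_walk f : (f \in walk s) = (f \in porbit s e).
Proof. by rewrite porbit_traject. Qed.

Lemma walk_conservative : conservative (F :\: [set f in walk s]).
Proof.
set C := F :\: _.
have CE f : (f \in C) = (f \notin porbit s e) && (f \in F).
  by rewrite finset.in_setD finset.in_set mem_walk.
have Cs f : (s f \in C) = (f \in C).
  rewrite !CE flow_support_stable -!eq_porbit_mem.
  by rewrite -[s f]/((s ^+ 1)%g f) porbit_perm.
have Cf f : f \in C -> follows f (s f).
  rewrite CE => /andP[fO fF]; apply: (flow_perm_follows hs fF) => /=.
  by apply: contraNneq fO => ->; rewrite -eq_porbit_mem e'_orbit.
apply/andP; split.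
  apply/forall_inP => f fC; rewrite /internal_edge (follows_internal hG (Cf f fC)) andbT.
  have gC : (s^-1%g f) \in C by rewrite -Cs permKV.
  have := Cf _ gC; rewrite permKV => gf.
  by rewrite -(eqP gf) (follows_internal hG gf).
apply/forallP => v; suff -> : C :&: out_edges (inr v) = s @: (C :&: in_edges (inr v)).
  by rewrite card_imset //; exact: perm_inj.
apply/setP => g; apply/idP/imsetP => [|[f fI ->]].
  rewrite finset.in_setI [g \in out_edges _]inE => /andP[gC /eqP tg].
  exists (s^-1%g g); last by rewrite permKV.
  have fC : (s^-1%g g) \in C by rewrite -Cs permKV.
  by rewrite finset.in_setI fC inE (eqP (Cf _ fC)) permKV tg /=.
have /andP[fC /eqP hf] : (f \in C) && (Defs.head f == inr v).
  by move: fI; rewrite finset.in_setI [f \in in_edges _]inE.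
by rewrite finset.in_setI Cs fC inE -(eqP (Cf _ fC)) hf /=.
Qed.

(** Needed because [flow_walk] is a choice. In a flow every edge but [e'] has one possible successor
    other than [e], so [P] follows [s] from [e], and it stops at the only occurrence of [e']. *)
Lemma walk_unique P : path_to e j P -> uniq P -> {subset P <= F} -> P = walk s.
Proof.
case: P => // f P /= /and3P[/eqP-> path_P /eqP last_P] /andP[eP uP] PF.
have bal := flow_support_balanced hG hs.
have step g h : g \in F -> h \in F -> follows g h -> h != e -> h = s g.
  move=> gF hF gh he; have ge : g != e'.
    by apply: contraTneq gh => ->; apply/negP => /(follows_internal hG); rewrite he'.
  have /andP[_ /forallP/(_ (Defs.head g))/andP[/eqP c1 c2]] := bal; rewrite c1 in c2.
  apply: (card_le1_eqP c2); rewrite inE ?flow_support_stable ?gF ?hF /=.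
    rewrite -(eqP (flow_perm_follows hs gF ge)) eqxx andbT -se'.
    by rewrite (inj_eq perm_inj).
  by rewrite he -(eqP gh) /=.
have fp Q g : g \in F -> path (@follows R n G) g Q -> e \notin Q -> {subset Q <= F} ->
    fpath s g Q.
  elim: Q g => //= h Q IH g gF /andP[gh hQ]; rewrite inE negb_or => /andP[eh eQ] sub.
  have hF : h \in F by apply: sub; exact: mem_head.
  have hs' : h = s g by apply: step => //; rewrite eq_sym.
  rewrite -hs' eqxx /=; apply: IH => // u uQ; apply: sub.
  by rewrite inE uQ orbT.
have {}fp : fpath s e P.
  apply: fp => //; first exact: PF (mem_head _ _).
  by move=> g gP; apply: PF; rewrite inE gP orbT.
have PE : e :: P = traject s e (size P).+1 by rewrite /= -(fpathE fp).
have lastP : iter (size P) s e = e'.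
  by apply: e'_uniq; rewrite -last_P (fpathE fp) size_traject last_traject.
rewrite PE /walk pE; congr (traject _ _ _.+1).
have nthE q i : (i < q.+1)%N -> nth e (traject s e q.+1) i = iter i s e.
  by move=> iq; exact: nth_traject.
have [lt|gt|//] := ltngtP (size P) p.
- have /(nth_uniq e) : uniq (traject s e p.+1) by rewrite -pE.
  move=> /(_ (size P) p); rewrite size_traject ltnS (ltnW lt) ltnSn => /(_ isT isT).
  by rewrite !nthE ?ltnS ?(ltnW lt) // lastP last_walk eqxx => /esym/eqP.
- have /(nth_uniq e) : uniq (traject s e (size P).+1) by rewrite -PE /= eP.
  move=> /(_ (size P) p); rewrite size_traject !ltnS leqnn (ltnW gt) => /(_ isT isT).
  by rewrite !nthE ?ltnS ?(ltnW gt) // lastP last_walk eqxx => /esym/eqP.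
Qed.

Lemma flow_walkE : flow_walk e j F = walk s.
Proof.
apply: xget_subset1.
  by split; [exact: walk_path_to | exact: walk_uniq | exact: walk_sub | exact: walk_conservative].
move=> P Q [P1 P2 P3 _] [Q1 Q2 Q3 _].
by rewrite (walk_unique P1 P2 P3) (walk_unique Q1 Q2 Q3).
Qed.

Lemma walk_contribution :
  (-1) ^+ s * \prod_(f | e' != f) (1%:M - T) f (s f) * (x e' * (-1) ^+ edge_int l e') =
  path_sign l S (flow_walk e j F) * \prod_(f in F) x f.
Proof.
(* The cofactor deletes the row of [e']; the value 1 stands in for the missing entry. *)
pose a f := if f == e' then 1 else (1%:M - T) f (s f).
have -> : \prod_(f | e' != f) (1%:M - T) f (s f) = \prod_f a f.
  rewrite [RHS](bigD1 e') //= {1}/a eqxx mul1r.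
  apply: eq_big => [f|f]; first by rewrite eq_sym.
  by rewrite /a eq_sym => /negPf->.
rewrite perm_sign_prod flow_walkE -prod_flow_support -(prod_porbits s).
have eO : porbit s e \in porbits s by exact: imset_f.
rewrite (bigD1 _ eO) [in RHS](bigD1 _ eO) /=.
rewrite [X in _ * X * _](_ : _ = \prod_(O in porbits s | O != porbit s e)
    \prod_(g in O) (if g \in F then x g else 1)); last first.
  apply: eq_bigr => _ /andP[/imsetP[f _ ->] Oe].
  have ne' : e' \notin porbit s f.
    by apply: contra Oe => h; rewrite eq_sym -e'_orbit eq_porbit_mem.
  rewrite -(porbit_contribution hG hl x hs (fun _ => ne')); congr (- _).
  apply: eq_bigr => g gO; rewrite /a; case: eqVneq => // ge.
  by move: ne'; rewrite -ge gO.
rewrite mulrAC [RHS]mulrA; congr (_ * _).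
rewrite !prod_porbit -/(walk s).
rewrite [X in _ = _ * X](_ : _ = \prod_(f <- walk s) x f); last first.
  by rewrite big_seq [RHS]big_seq; apply: eq_bigr => g /walk_sub->.
rewrite [in RHS]/walk pE path_sign_traject last_walk; congr (_ * _).
(* The minus sign of the orbit cancels against that of the placeholder at [e'], so the open walk
   keeps just its path sign. *)
rewrite walk_rcons big_rcons /= {2}/a eqxx mulrN1 opprK.
rewrite big_seq [RHS]big_seq; apply: eq_bigr => g /front_follows[ge gs].
rewrite /a (negPf ge) transfer_diag ?opprK ?mxE ?gs //.
by apply: contraTneq gs => <-; rewrite (follows_irrefl hG).
Qed.

End OnePerm.

(** [last_step] is supported on [e'], so a single adjugate entry survives; its expansion runs over
    the permutations sending [e'] to [e]. *)
Lemma adj_transfer_last_step :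
  (\adj (1%:M - T) *m last_step l x j) e ord0 = edge_flow_gf l x e j.
Proof.
rewrite mxE (bigD1 e') //= [X in _ + X]big1 ?addr0; last first.
  move=> f fe; rewrite [last_step _ _ _ _ _]mxE ifF ?mulr0 //.
  by apply: contraNF fe => /eqP/e'_uniq->.
rewrite !mxE he' eqxx expand_cofactor big_distrl /=.
rewrite /edge_flow_gf (eq_bigl _ _ (fun F => edge_flow_to_balanced hG e F he' e'_uniq)).
rewrite (big_balanced hG) big_mkcond [RHS]big_mkcond /=; apply: eq_bigr => s _.
have [hs|hs] := boolP (flow_perm true e e' s).
  by rewrite (flow_perm_special hs) // eqxx walk_contribution.
case: ifP => // se; move: hs; rewrite /flow_perm /= se /= => /forallPn[f].
rewrite !negb_or => /andP[/andP[fe' sf] ff].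
rewrite (bigD1 f) /=; last by rewrite eq_sym.
by rewrite transfer_diag 1?eq_sym // mxE (negPf ff) oppr0 mul0r mulr0 mul0r.
Qed.

End Expansion.

(** * Series expansions *)

Section FormalPowerSeries.
Variables (R : realType) (m : nat).
Implicit Types (p q : {mpoly R[m]}) (s : fps R m) (mu : 'X_{1..m}).

Lemma fps_mul_coef q s p mu :
  (forall nu, (mdeg nu <= mdeg mu)%N -> s nu = p@_nu) -> fps_mul q s mu = (q * p)@_mu.
Proof.
move=> sp; rewrite (mcoeff_poly_mul_lin _ _ (ltnSn (mdeg mu))).
by apply: eq_bigr => a _; rewrite sp // mdegB.
Qed.

Lemma mcoeffM_eq p p' q mu :
  (forall nu, (mdeg nu <= mdeg mu)%N -> p@_nu = p'@_nu) -> (q * p)@_mu = (q * p')@_mu.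
Proof. by move=> h; rewrite -(@fps_mul_coef q (fun nu => p@_nu) p) // (@fps_mul_coef q _ p'). Qed.

(* [Y N] plays the role of the truncation of [s] in degrees at most [N]. *)
Lemma fps_valueE s (Y : nat -> {mpoly R[m]}) (w : 'I_m -> R) p q :
  (forall N nu, (mdeg nu <= N)%N -> s nu = (Y N)@_nu) ->
  (forall mu, fps_mul q s mu = p@_mu) -> q.@[w] != 0 ->
  fps_value s w = p.@[w] / q.@[w].
Proof.
move=> sY pq qw; apply: xget_subset1; first by exists p, q.
have trunc p' q' : (forall mu, fps_mul q' s mu = p'@_mu) ->
    forall N nu, (mdeg nu <= N)%N -> p'@_nu = (q' * Y N)@_nu.
  move=> h N nu nuN; rewrite -h; apply: fps_mul_coef => a anu; apply: sY.
  exact: leq_trans anu nuN.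
move=> _ _ [p1 [q1 [h1 w1 ->]]] [p2 [q2 [h2 w2 ->]]].
suff E : q2 * p1 = q1 * p2.
  apply/eqP; rewrite eqr_div // -!mevalM; apply/eqP; congr meval.
  by rewrite mulrC E mulrC.
apply/mpolyP => mu.
rewrite (mcoeffM_eq q2 (fun nu h => trunc _ _ h1 (mdeg mu) nu h)).
rewrite (mcoeffM_eq q1 (fun nu h => trunc _ _ h2 (mdeg mu) nu h)).
by rewrite mulrCA.
Qed.

Lemma mpoly_prod_seq (P : seq 'I_m) :
  \prod_(f <- P) 'X_f = 'X_[[multinom count_mem f P | f < m]] :> {mpoly R[m]}.
Proof.
elim: P => [|g P IH].
  by rewrite big_nil -mpolyX0; congr 'X_[_]; apply/mnmP => f; rewrite !mnmE.
rewrite big_cons IH -mpolyXD; congr 'X_[_]; apply/mnmP => f.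
by rewrite mnmDE !mnmE.
Qed.

Lemma mdeg_count (P : seq 'I_m) : mdeg [multinom count_mem f P | f < m] = size P.
Proof.
elim: P => [|g P IH].
  by rewrite mdegE big1 // => f _; rewrite mnmE.
rewrite /= -IH -add1n -(mdeg1 g) -mdegD; congr mdeg; apply/mnmP => f.
by rewrite mnmDE !mnmE.
Qed.

End FormalPowerSeries.

Section Series.
Variables (R : realType) (n k : nat) (G : drawing R n).
Hypothesis hG : plabic G k.
Variables (l : R * R) (hl : gauge_direction G l).
Local Notation edge := 'I_(ne G).
Local Notation X := (@edge_indeterminate R n G).

Lemma path_sum_recurrence (S : comNzRingType) (x : edge -> S) (e : edge) j N :
  j \notin sources G ->
  conservative_gf x * \sum_(m < N.+1) path_sum l x e j m =
  edge_flow_gf l x e j -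
  \sum_f \adj (1%:M - transfer l x) e f * path_sum l x f j N.+1.
Proof.
move=> js; have [e' he' e'_uniq] := sink_edge hG js.
rewrite -(det_transfer hG hl x e) det_path_sum (adj_transfer_last_step hG hl x e he' e'_uniq).
by rewrite [in LHS]mxE; congr (_ - _); apply: eq_bigr => f _; rewrite path_sumS.
Qed.

(** Paths with [m] edges have monomials of degree [m], so grouping by length is grouping by degree
    and partial sums are truncations. *)
Lemma mcoeff_path_sum e j m mu :
  (path_sum l X e j m)@_mu = if m == mdeg mu then edge_series l e j mu else 0.
Proof.
have term (P : seq edge) : (path_sign l {mpoly R[ne G]} P * \prod_(f <- P) X f)@_mu =
    path_sign l R P * ([multinom count_mem f P | f < ne G] == mu)%:R.
  rewrite mpoly_prod_seq /path_sign -[(-1) ^+ _](rmorph_sign (@mpolyC _ R)).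
  by rewrite mcoeffCM mcoeffX.
rewrite /path_sum raddf_sum /=; under eq_bigr => P _ do rewrite term.
case: eqP => [->|mmu].
  rewrite /edge_series /path_series [LHS]big_mkcond [RHS]big_mkcond /=.
  apply: eq_bigr => P _; case: (path_to e j P) => //=.
  by case: eqP; rewrite ?mulr1 ?mulr0.
rewrite big1 // => P _; case: eqP => [E|]; last by rewrite mulr0.
by case: mmu; rewrite -E mdeg_count size_tuple.
Qed.

Lemma edge_series_trunc e j N mu : (mdeg mu <= N)%N ->
  edge_series l e j mu = (\sum_(m < N.+1) path_sum l X e j m)@_mu.
Proof.
move=> muN; rewrite raddf_sum /= (bigD1 (Ordinal (muN : (mdeg mu < N.+1)%N))) //=.
rewrite mcoeff_path_sum eqxx big1 ?addr0 // => m; rewrite -val_eqE /= => ne.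
by rewrite mcoeff_path_sum (negPf ne).
Qed.

Lemma edge_series_rational e j mu : j \notin sources G ->
  fps_mul (conservative_gf X) (edge_series l e j) mu = (edge_flow_gf l X e j)@_mu.
Proof.
move=> js; rewrite (fps_mul_coef _ (fun nu h => edge_series_trunc e j h)).
(* The remainder is a combination of path sums homogeneous of degree [mdeg mu + 1], invisible at
   [mu]. *)
rewrite path_sum_recurrence // mcoeffB [X in _ - X](_ : _ = 0) ?subr0 //.
rewrite raddf_sum big1 // => f _ /=.
rewrite (mcoeffM_eq (p' := 0)) ?mulr0 ?mcoeff0 // => nu nuN.
by rewrite mcoeff_path_sum mcoeff0 ifF //; apply/eqP => E; move: nuN; rewrite -E ltnn.
Qed.

Lemma meval_conservative_gf (w : edge -> R) : (conservative_gf X).@[w] = conservative_gf w.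
Proof.
rewrite /conservative_gf rmorph_sum; apply: eq_bigr => C _.
by rewrite rmorph_prod; apply: eq_bigr => f _; exact: mevalXU.
Qed.

Lemma meval_edge_flow_gf (w : edge -> R) e j :
  (edge_flow_gf l X e j).@[w] = edge_flow_gf l w e j.
Proof.
rewrite /edge_flow_gf rmorph_sum; apply: eq_bigr => C _.
rewrite rmorphM rmorph_prod /path_sign rmorph_sign; congr (_ * _).
by apply: eq_bigr => f _; exact: mevalXU.
Qed.

Lemma conservative_gf_gt0 (w : edge -> R) : (forall f, 0 < w f) -> 0 < conservative_gf w.
Proof.
move=> w0; rewrite /conservative_gf (bigD1 finset.set0) /=.
  rewrite big_set0 ltr_wpDr ?ltr01 //; apply: sumr_ge0 => C _.
  by apply: prodr_ge0 => f _; exact: ltW.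
apply/andP; split; first by apply/forall_inP => f; rewrite inE.
by apply/forallP => v; rewrite !finset.set0I.
Qed.

Lemma path_weight_le (w : edge -> R) (r : R) P : (forall f, 0 < w f < r) ->
  `|path_weight w P| <= r ^+ size P.
Proof.
move=> wr; rewrite /path_weight; elim: P => [|f P IH]; first by rewrite big_nil normr1.
have /andP[w0 wf] := wr f.
by rewrite big_cons normrM exprS ler_pM // gtr0_norm // ltW.
Qed.

Lemma edge_abs_term_le (w : edge -> R) (r : R) e j m :
  0 <= r -> (forall f, 0 < w f < r) -> edge_abs_term w e j m <= ((ne G)%:R * r) ^+ m.
Proof.
move=> r0 wr; rewrite /edge_abs_term big_mkcond.
have -> : ((ne G)%:R * r) ^+ m = \sum_(P : m.-tuple edge) r ^+ m.
  by rewrite sumr_const card_tuple card_ord exprMn -natrX mulr_natl.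
apply: ler_sum => P _; case: ifP => _; last exact: exprn_ge0.
by rewrite -{2}(size_tuple P); exact: path_weight_le.
Qed.

Lemma path_sum_le_abs (w : edge -> R) e j m :
  `|path_sum l w e j m| <= edge_abs_term w e j m.
Proof.
apply: le_trans (ler_norm_sum _ _ _) _; apply: ler_sum => P _.
by rewrite normrM /path_sign normrX normrN1 expr1n mul1r.
Qed.

Lemma cvg_sum0 (I : Type) (r : seq I) (F : I -> nat -> R) :
  (forall i, F i @ \oo --> 0)%classic ->
  ((fun N => \sum_(i <- r) F i N) @ \oo --> 0)%classic.
Proof.
move=> H; elim: r => [|i r IH].
  by under eq_fun do rewrite big_nil; exact: cvg_cst.
under eq_fun do rewrite big_cons.
by have := cvgD (H i) IH; rewrite addr0; exact.
Qed.

(** There are at most [(ne G) ^ m] paths with [m] edges, so this bound on the weights makes the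
    terms at most [2 ^ (- m)] in absolute value, and the remainder of the recurrence tends to 0. *)
Lemma edge_term_cvg (w : edge -> R) e j : j \notin sources G ->
  (forall f, 0 < w f < (2 * (ne G).+1%:R)^-1) ->
  cvgn (series (edge_abs_term w e j)) /\
  (series (edge_term l w e j) @ \oo --> edge_flow_gf l w e j / conservative_gf w)%classic.
Proof.
move=> js ws; have half1 : `|2^-1 : R| < 1 by rewrite ger0_norm ?invr_ge0 // invf_lt1 // ltr1n.
have r0 : 0 <= (2 * (ne G).+1%:R)^-1 :> R by rewrite invr_ge0 mulr_ge0.
have bound f m : edge_abs_term w f j m <= geometric 1 2^-1 m.
  apply: le_trans (edge_abs_term_le f j m r0 ws) _; rewrite /= mul1r.
  apply: lerXn2r; rewrite ?nnegrE ?invr_ge0 ?mulr_ge0 //.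
  rewrite invfM mulrCA ler_piMr ?invr_ge0 // ler_pdivrMr ?ltr0n // mul1r ler_nat.
  exact: leqnSn.
have abs_ge0 f m : 0 <= edge_abs_term w f j m by apply: sumr_ge0.
split.
  apply: (series_le_cvg (v_ := geometric 1 2^-1)) => // [m|]; first exact: le_trans (bound e m).
  by apply: cvgP; exact: cvg_geometric_series.
have ps0 f : ((fun N => path_sum l w f j N) @ \oo --> 0)%classic.
  have g0 := cvg_geometric 1 half1.
  apply: (@squeeze_cvgr _ _ _ _ (fun m => - geometric 1 2^-1 m) (fun m => geometric 1 2^-1 m)).
  - apply: nearW => m; rewrite -ler_norml.
    exact: le_trans (path_sum_le_abs _ _ _ _) (bound _ _).
  - by rewrite -oppr0; apply: cvgN.
  - exact: g0.
have c0 : 0 < conservative_gf w.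
  by apply: conservative_gf_gt0 => f; case/andP: (ws f).
(* The recurrence describes partial sums with [N.+1] terms, starting with the zero contribution of
   length 0. *)
rewrite -cvg_shiftS.
have -> : [sequence series (edge_term l w e j) N.+1]_N = (fun N =>
    (edge_flow_gf l w e j - \sum_f \adj (1%:M - transfer l w) e f * path_sum l w f j N.+1) /
    conservative_gf w).
  apply: funext => N; rewrite -path_sum_recurrence // mulrC mulKf ?gt_eqF //.
  by rewrite /series /= big_mkord.
apply: cvgMl.
have rem0 : ((fun N => \sum_f \adj (1%:M - transfer l w) e f * path_sum l w f j N.+1) @ \oo --> 0)%classic.
  apply: cvg_sum0 => f; rewrite -(mulr0 (\adj (1%:M - transfer l w) e f)).
  by apply: cvgMr; have := ps0 f; rewrite -cvg_shiftS; exact.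
by have := cvgB (cvg_cst (edge_flow_gf l w e j)) rem0; rewrite subr0; exact.
Qed.

End Series.

Theorem theorem4p1 (R : realType) (k n : nat) (hk : (0 < k)%N) (hkn : (k < n)%N)
  (G : drawing R n) (hG : plabic G k)
  (w : 'I_(ne G) -> R) (hw : forall f, 0 < w f)
  (l : R * R) (hl : gauge_direction G l)
  (M : {set {set 'I_n}}) (hM : matroid k M)
  (A : 'M[R]_(k, n)) (hA : in_tnn_cell M A)
  (i : 'I_k -> 'I_n) (hi : increasing i)
  (hI : i @: [set: 'I_k]%SET = sources G) (hIM : sources G \in M)
  (hrep : represents w i A)
  (V : lmodType R) (B : 'I_n -> V) (e : 'I_(ne G)) :
  [/\ (* subtraction-free denominator *)
      0 < conservative_gf w,
      (* equality of the edge vector of the network with the rational expression *)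
      edge_vector l w B e =
        \sum_(j | j \notin sources G)
          (edge_flow_gf l w e j / conservative_gf w) *: B j,
      (* the same equality for formal power series in the weights *)
      forall j mu, j \notin sources G ->
        fps_mul (conservative_gf (@edge_indeterminate R n G))
                (edge_series l e j) mu =
        (edge_flow_gf l (@edge_indeterminate R n G) e j)@_mu &
      (* and for the sums in R when the weights are small *)
      exists2 eps : R, 0 < eps &
        forall w' : 'I_(ne G) -> R, (forall f, 0 < w' f < eps) ->
        forall j, j \notin sources G ->
          cvgn (series (edge_abs_term w' e j)) /\
          (series (edge_term l w' e j) @ \oo -->
             (edge_flow_gf l w' e j / conservative_gf w'))%classic].
Proof.
have c0 := conservative_gf_gt0 hw.
split=> //.
- apply: eq_bigr => j js; congr (_ *: _).
  rewrite (fps_valueE (w := w) (fun N nu h => edge_series_trunc l e j h)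
    (fun mu => edge_series_rational hG hl e mu js)).
    by rewrite meval_conservative_gf meval_edge_flow_gf.
  by rewrite meval_conservative_gf gt_eqF.
- by move=> j mu; exact: (edge_series_rational hG hl).
- exists (2 * (ne G).+1%:R)^-1; first by rewrite invr_gt0 mulr_gt0 // ltr0n.
  by move=> w' hw' j js; exact: (edge_term_cvg hG hl).
Qed.
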